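(* Let $n,m,n_1,\dots,n_m\ge 1$ be integers and, for $1\le j\le m$, let $P_j:\mathbb Z^n\to\mathbb Z^{n_j}$ be a polynomial map with integer coefficients whose image is not contained in any proper affine subspace. Let $1\le q_1,\dots,q_m\le+\infty$ satisfy the scaling condition $$n=\sum_{j=1}^m\frac{n_j}{q_j},$$ and suppose $a\in\mathbb Z^n$ is such that $$\operatorname{rank}(dP_j(a))=n_j\quad\text{for all }1\le j\le m,$$ $$\operatorname{rank}(V)\le\sum_{j=1}^m\frac{\operatorname{rank}\big(dP_j(a)(V)\big)}{q_j}\quad\text{for every subgroup }V\le\mathbb Z^n.$$ Then there is a positive integer $\Delta_a=\Delta_a(d\mathbf P(a))$, determinable by an algorithm as a function of $d\mathbf P(a)=(dP_j(a))_{1\le j\le m}$, such that the following holds. If $p$ is a prime number with $p\nmid\Delta_a$, then for any functions $f_j:\mathbb Z^{n_j}\to\mathbb C$, $1\le j\le m$, $$\left|\sum_{x\in a+p\mathbb Z^n}\prod_{j=1}^m f_j(P_j(x))\right|\le\prod_{j=1}^m\|f_j\|_{\ell^{q_j}(\mathbb Z^{n_j})}.$$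
   Context: $dP_j(a)$ denotes the $n_j\times n$ Jacobian matrix of $P_j$ at $a$, an integer matrix, regarded as a homomorphism $\mathbb Z^n\to\mathbb Z^{n_j}$; $dP_j(a)(V)$ is the image subgroup, and the rank of a subgroup is its rank as a free abelian group. $1/q_j=0$ when $q_j=+\infty$, and $\ell^{q}$ norms are with respect to counting measure. The inequality is to be read as vacuous when the right-hand side is $+\infty$. *)

(* Defs.v *)
From HB Require Import structures.
From mathcomp Require Import all_boot all_order all_algebra finmap.
From mathcomp Require Import complex.
From mathcomp Require mpoly.
From mathcomp Require Import all_classical all_reals all_analysis.
From mathcomp.analysis.showcase Require Import summability.

Set Implicit Arguments.
Unset Strict Implicit.
Unset Printing Implicit Defensive.
Import Order.TTheory GRing.Theory Num.Theory.
Import numFieldNormedType.Exports.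

Local Open Scope classical_set_scope.
Local Open Scope ring_scope.

(* Partial mu-recursive functions, as programs with a big-step semantics;
   [computes e xs y] means that [e] halts on the arguments [xs] with value [y]. *)
Inductive program : Type :=
| Zero
| Succ
| Proj of nat
| Comp of program & seq program
| PrimRec of program & program
| Mu of program.

Inductive computes : program -> seq nat -> nat -> Prop :=
| computes_Zero xs : computes Zero xs 0
| computes_Succ x xs : computes Succ (x :: xs) x.+1
| computes_Proj i xs : (i < size xs)%N -> computes (Proj i) xs (nth 0%N xs i)
| computes_Comp e es xs ys y :
    computes_all es xs ys -> computes e ys y -> computes (Comp e es) xs y
| computes_PrimRec0 e e' xs y :
    computes e xs y -> computes (PrimRec e e') (0%N :: xs) y
| computes_PrimRecS e e' k xs r y :
    computes (PrimRec e e') (k :: xs) r -> computes e' [:: k, r & xs] y ->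
    computes (PrimRec e e') (k.+1 :: xs) y
| computes_Mu e xs k (v : nat -> nat) :
    (forall i, (i < k)%N -> computes e (i :: xs) (v i).+1) ->
    computes e (k :: xs) 0 -> computes (Mu e) xs k
with computes_all : seq program -> seq nat -> seq nat -> Prop :=
| computes_nil xs : computes_all [::] xs [::]
| computes_cons e es xs y ys :
    computes e xs y -> computes_all es xs ys ->
    computes_all (e :: es) xs (y :: ys).

Definition code_int (z : int) : nat :=
  match z with Posz k => k.*2 | Negz k => k.*2.+1 end.

(* The sizes n, m, d_0, ..., d_(m-1), then the entries of the m matrices one
   after the other, row by row. *)
Definition code_matrices (n m : nat) (d : 'I_m -> nat)
    (J : forall j : 'I_m, 'M[int]_(d j, n)) : nat :=
  CodeSeq.code
    (n :: m :: [seq d j | j <- enum 'I_m] ++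
     flatten [seq flatten [seq [seq code_int (J j i k) | k <- enum 'I_n]
                              | i <- enum 'I_(d j)]
                 | j <- enum 'I_m]).

(* A k-tuple of integer polynomials in n variables, as a map Z^n -> Z^k. *)
Definition polynomial_map (n k : nat) (P : 'I_k -> mpoly.mpoly n int)
    (x : 'cV[int]_n) : 'cV[int]_k :=
  \col_i mpoly.meval (fun l => x l 0) (P i).

Definition polynomial_jacobian (n k : nat) (P : 'I_k -> mpoly.mpoly n int)
    (a : 'cV[int]_n) : 'M[int]_(k, n) :=
  \matrix_(i, l) mpoly.meval (fun l' => a l' 0) (mpoly.mderiv l (P i)).

(* Affine subspaces v + W of Q^k. *)
Definition in_proper_affine_subspace (k : nat) (A : set 'cV[int]_k) : Prop :=
  exists (v : 'cV[rat]_k) (W : {vspace 'cV[rat]_k}),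
    W != fullv /\ forall y, A y -> map_mx intr y - v \in W.

Definition matrix_rank (k n : nat) (A : 'M[int]_(k, n)) : nat :=
  \rank (map_mx intr A : 'M[rat]_(k, n)).

(* The columns of B form a basis of V. *)
Definition is_Zbasis (k r : nat) (V : set 'cV[int]_k) (B : 'M[int]_(k, r)) :=
  injective (fun c : 'cV[int]_r => B *m c) /\
  V = range (fun c : 'cV[int]_r => B *m c).

Definition free_rank (k : nat) (V : set 'cV[int]_k) : nat :=
  xget 0%N [set r | exists B : 'M[int]_(k, r), is_Zbasis V B].

Definition coset_pZ (n p : nat) (a : 'cV[int]_n) : set 'cV[int]_n :=
  [set a + y *+ p | y in [set: 'cV[int]_n]].

(* [measurableType] requires a point. *)
HB.instance Definition _ := isPointed.Build int 0.

Section AnalysisDefs.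
Variable R : realType.

Definition lq_norm (T : pointedType) (q : \bar R) (f : T -> R[i]) : \bar R :=
  Lnorm (@counting (g_sigma_algebraType [set: set T]) R) q
    (fun y => (Normc.normc (f y))%:E).

(* Unconditional summation: convergence along the finite subsets of D. *)
Definition has_sum (T : choiceType) (D : set T) (F : T -> R[i]) (S : R[i]) :=
  partial_sum (patch (fun=> 0) D F) @ totally --> (S : R[i]^o).

End AnalysisDefs.

(* Main.v *)
(* With [s_j = 1 / q_j], the linear inequality
     sum_(x in E) prod_j h_j(J_j x)^s_j <= prod_j (sum h_j)^s_j
   holds with constant 1 over any field as soon as every subspace V satisfies
   dim V <= sum_j s_j dim(J_j V). Both sides behave convexly in s, so only
   vertices of the polytope of admissible s matter; at a vertex some s_j is 1 and
   one fibres over J_j, or some proper nonzero V attains equality and one splits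
   into V and the quotient.

   The Jacobians satisfy the rank condition over Q. If it failed modulo p for some
   subspace W, it would fail at a vertex s, which has bounded denominators, hence
   by a margin bounded below; but the linear inequality over Q, applied to the
   lifts of the points of W to [0, p)^n, gives |W| <= C prod_j |J_j W|^s_j with C
   independent of p. So it holds modulo every p larger than an explicit bound N(J), and
   Delta = N(J)! has the required property.

   For such p the nonlinear inequality follows by induction on scales: on
   x_0 + p^k Z^n with x_0 = a mod p, the residue of P_j(x) mod p^(k+1) is an affine
   function of the digit of x at p^k, with linear part J_j mod p, so the linear
   inequality over F_p passes from the cosets of p^(k+1) to those of p^k. A finite
   set of points is separated at some scale. *)

Require Import Defs.
From mathcomp Require Import all_boot all_order all_algebra finmap.
From mathcomp Require Import perm complex.
From mathcomp Require mpoly.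
From mathcomp Require Import all_classical all_reals all_analysis.
From mathcomp.analysis Require Import ess_sup_inf.
From mathcomp.analysis.showcase Require Import summability.
From mathcomp Require Import ring lra zify.

Set Implicit Arguments.
Unset Strict Implicit.
Unset Printing Implicit Defensive.
Import Order.TTheory GRing.Theory Num.Theory.
Import numFieldNormedType.Exports.
Import (canonicals, coercions) mpoly.

Local Open Scope classical_set_scope.
Local Open Scope ring_scope.

(** * Convexity on polytopes *)

Definition pairing (R : realFieldType) (m : nat) (g : 'I_m -> int)
    (s : 'I_m -> R) : R :=
  \sum_k (g k)%:~R * s k.

Lemma pairing_line (R : realFieldType) (m : nat) (g : 'I_m -> int)
    (s v : 'I_m -> R) (t : R) :
  pairing g (fun k => s k + t * v k) = pairing g s + t * pairing g v.
Proof.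
rewrite /pairing mulr_sumr -big_split; apply: eq_bigr => k _ /=.
by rewrite mulrDr mulrCA.
Qed.

Definition feasible (R : realFieldType) (m : nat) (I : finType)
    (g : I -> 'I_m -> int) (b : I -> int) (s : 'I_m -> R) : Prop :=
  forall i, (b i)%:~R <= pairing (g i) s.

Definition tight (R : realFieldType) (m : nat) (I : finType)
    (g : I -> 'I_m -> int) (b : I -> int) (s : 'I_m -> R) : {set I} :=
  [set i | (b i)%:~R == pairing (g i) s].

(** Equivalently, the tight normals span the dual space; in this form Cramer's rule applies to the
    tight constraints. *)
Definition vertex (R : realFieldType) (m : nat) (I : finType)
    (g : I -> 'I_m -> int) (b : I -> int) (s : 'I_m -> R) : Prop :=
  forall v : 'I_m -> R, (forall i, i \in tight g b s -> pairing (g i) v = 0) ->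
  forall k, v k = 0.

(** Tight constraints stay tight along [v]. Among those that decrease, the first to become tight has
    the least ratio of slack to rate of decrease, and [t] is that ratio. *)
Lemma exit_feasible (R : realFieldType) (m : nat) (I : finType)
    (g : I -> 'I_m -> int) (b : I -> int) (s v : 'I_m -> R) :
  feasible g b s -> (forall i, i \in tight g b s -> pairing (g i) v = 0) ->
  (exists i, pairing (g i) v < 0) ->
  exists t, [/\ 0 < t, feasible g b (fun k => s k + t * v k)
    & tight g b s \proper tight g b (fun k => s k + t * v k)].
Proof.
move=> fs tv [i0 i0v].
pose slack i := (pairing (g i) s - (b i)%:~R) / - pairing (g i) v.
pose i1 := [arg min_(i < i0 | pairing (g i) v < 0) slack i]%O.
have [i1v i1min] : pairing (g i1) v < 0 /\
    forall i, pairing (g i) v < 0 -> slack i1 <= slack i.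
  by rewrite /i1; case: arg_minP.
have i1s : (b i1)%:~R < pairing (g i1) s.
  rewrite lt_neqAle fs andbT; apply/negP => ti.
  by move: i1v; rewrite tv ?ltxx// inE.
have t0 : 0 < slack i1 by rewrite divr_gt0 ?subr_gt0 ?oppr_gt0.
exists (slack i1); split => //.
- move=> i; rewrite pairing_line; have [iv|iv] := ltP (pairing (g i) v) 0.
    have : slack i1 * - pairing (g i) v <= pairing (g i) s - (b i)%:~R.
      by rewrite -ler_pdivlMr ?oppr_gt0//; exact: i1min.
    by rewrite mulrN -subr_ge0 opprK addrAC subr_ge0.
  by rewrite (le_trans (fs i))// lerDl mulr_ge0// ltW.
- apply/properP; split.
    apply/fintype.subsetP => i it; have := it.
    by rewrite !inE pairing_line (tv i it) mulr0 addr0.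
  exists i1; rewrite !inE ?(lt_eqF i1s)// pairing_line.
  by rewrite /slack invrN mulrN mulNr divfK ?ltr0_neq0// opprB addrC subrK.
Qed.

(** The first hypothesis says that the polytope contains no ray. A point that is not a vertex can be
    moved along some [v] and along its opposite until a new constraint becomes tight; it is then a
    convex combination of two points with fewer slack constraints, and the induction is on their
    number. *)
Lemma polytope_ind (R : realFieldType) (m : nat) (I : finType)
    (g : I -> 'I_m -> int) (b : I -> int) (Phi : ('I_m -> R) -> Prop) :
  (forall v : 'I_m -> R, (exists k, v k <> 0) -> exists i, pairing (g i) v < 0) ->
  (forall (s1 s2 : 'I_m -> R) (t : R), feasible g b s1 -> feasible g b s2 ->
    0 < t < 1 -> Phi s1 -> Phi s2 -> Phi (fun k => t * s1 k + (1 - t) * s2 k)) ->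
  (forall s, feasible g b s -> vertex g b s -> Phi s) ->
  forall s, feasible g b s -> Phi s.
Proof.
move=> gspan Phiconv Phivert s.
have [N] := ubnP #|~: tight g b s|; elim: N s => // N IH s sN fs.
have [|] := pselect (vertex g b s); first exact: Phivert.
move=> /existsNP[v /not_implyP[tv /existsNP[k vk]]].
have tNv i : i \in tight g b s -> pairing (g i) (fun k => - v k) = 0.
  move=> it; rewrite -[RHS]oppr0 -(tv i it) /pairing -sumrN.
  by apply: eq_bigr => l _; rewrite mulrN.
have NvN : exists l, - v l <> 0 by exists k => /eqP; rewrite oppr_eq0 => /eqP.
have [t [t0 ft pt]] := exit_feasible fs tv (gspan v (ex_intro _ k vk)).
have [u [u0 fu pu]] := exit_feasible fs tNv (gspan _ NvN).
have Phit : Phi (fun k => s k + t * v k).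
  by apply: IH => //; rewrite -ltnS (leq_trans _ sN)// ltnS proper_card// finset.properC.
have Phiu : Phi (fun k => s k + u * - v k).
  by apply: IH => //; rewrite -ltnS (leq_trans _ sN)// ltnS proper_card// finset.properC.
have tu : t + u != 0 by rewrite gt_eqF// addr_gt0.
rewrite (_ : s = fun k => u / (t + u) * (s k + t * v k) +
                       (1 - u / (t + u)) * (s k + u * - v k)).
  apply: Phiconv => //; rewrite divr_gt0 ?addr_gt0//=.
  by rewrite ltr_pdivrMr ?addr_gt0// mul1r ltrDr.
by apply/funext => l; field.
Qed.

Lemma absz_det_le (m H : nat) (A : 'M[int]_m) :
  (forall i k, `|A i k|%N <= H)%N -> (`|\det A|%N <= m`! * H ^ m)%N.
Proof.
move=> AH; rewrite -lez_nat abszE.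
apply: le_trans (ler_norm_sum _ _ _) _.
apply: (@le_trans _ _ (\sum_(u : 'S_m) (H ^ m)%N%:Z)).
  apply: ler_sum => u _; rewrite normrM normrX normrN1 expr1n mul1r normr_prod.
  rewrite -[X in (H ^ X)%N](card_ord m) -prod_nat_const -natz natr_prod.
  apply: ler_prod => i _; rewrite normr_ge0/=.
  by rewrite natz -abszE lez_nat AH.
by rewrite sumr_const card_Sn PoszM -mulr_natl natz.
Qed.

(** Cramer's rule for [m] independent tight constraints: [D] is the absolute value of their
    determinant, bounded through the Leibniz expansion. *)
Lemma vertex_denominator (R : realFieldType) (m : nat) (I : finType)
    (g : I -> 'I_m -> int) (b : I -> int) (s : 'I_m -> R) (H : nat) :
  (forall i k, `|g i k|%N <= H)%N -> vertex g b s ->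
  exists D : nat, (0 < D <= m`! * H ^ m)%N /\
    forall k, exists z : int, D%:R * s k = z%:~R.
Proof.
move=> gH vs.
pose T := tight g b s.
(* Slack constraints become zero rows, so that the rows are still indexed by all of [I]. *)
pose Gz : 'M[int]_(#|I|, m) := \matrix_(i, k) (if enum_val i \in T then g (enum_val i) k else 0).
pose bz : 'cV[int]_#|I| := \col_i (if enum_val i \in T then b (enum_val i) else 0).
pose G : 'M[R]_(#|I|, m) := map_mx intr Gz.
have Gs : G *m (\col_k s k) = map_mx intr bz.
  apply/matrixP => i j; rewrite !mxE.
  under eq_bigr do rewrite !mxE.
  case: ifP => [iT|_]; last by rewrite big1// => k _; rewrite mul0r.
  by have := iT; rewrite inE => /eqP ->.
(* A vector orthogonal to all the rows is a direction keeping every tight constraint tight, hence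
   zero at a vertex. *)
have Gfull : row_full G.
  rewrite /row_full -mxrank_tr -/(row_free G^T) -kermx_eq0.
  apply/eqP/row_matrixP => l; rewrite row0; apply/rowP => k; rewrite [RHS]mxE.
  have : row l (kermx G^T) *m G^T = 0 by rewrite -row_mul mulmx_ker row0.
  move: (row l _) => w wG.
  apply: (vs (fun k => w 0 k)) => i iT.
  have /rowP/(_ (enum_rank i)) := wG; rewrite !mxE => <-.
  by apply: eq_bigr => k' _; rewrite !mxE enum_rankK iT mulrC.
pose f := fullrankfun Gfull.
have Gu : rowsub f G \in unitmx := fullrowsub_unit Gfull.
have GfE : rowsub f G = map_mx intr (rowsub f Gz) by rewrite map_mxsub.
have detE : \det (rowsub f G) = (\det (rowsub f Gz))%:~R by rewrite GfE det_map_mx.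
have det0 : \det (rowsub f Gz) != 0.
  apply: contraTneq Gu => d0; by rewrite unitmxE detE d0 unitr0.
exists `|\det (rowsub f Gz)|%N; split.
  rewrite absz_gt0 det0 absz_det_le// => i k; rewrite !mxE.
  by case: ifP => // _; rewrite absz0.
move=> k; exists (sgz (\det (rowsub f Gz)) * (\adj (rowsub f Gz) *m rowsub f bz) k 0).
have sE : (\det (rowsub f Gz))%:~R * s k = ((\adj (rowsub f Gz) *m rowsub f bz) k 0)%:~R.
  have : \adj (rowsub f G) *m (rowsub f G *m (\col_k s k)) =
         map_mx intr (\adj (rowsub f Gz) *m rowsub f bz).
    rewrite mul_rowsub_mx Gs map_mxM map_mx_adj -GfE map_mxsub.
    by [].
  rewrite mulmxA mul_adj_mx mul_scalar_mx detE.
  by move=> /matrixP/(_ k 0); rewrite !mxE.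
rewrite intrM -sE mulrA -intrM; congr (_ * _).
by rewrite pmulrn abszE normrEsg sgrz.
Qed.

(** * The polytope of a rank condition *)

(** Vectors are rows: a subspace is the row space of [A], its image is that of [A *m J j], and the
    [J j] will be transposed Jacobians. *)
Definition rank_condition (R : realFieldType) (K : fieldType) (n m : nat)
    (d : 'I_m -> nat) (J : forall j, 'M[K]_(n, d j)) (s : 'I_m -> R) : Prop :=
  (forall j, 0 <= s j <= 1) /\
  forall k (A : 'M[K]_(k, n)),
    (\rank A)%:R <= \sum_j s j * (\rank (A *m J j))%:R.

(** The possible dimensions of a subspace and of its [m] images. Over an infinite field there may be
    infinitely many subspaces, but only finitely many such tuples, so finitely many inequalities cut
    out the admissible [s]. *)
Definition rank_type (n m : nat) : finType :=
  ('I_n.+1 * {ffun 'I_m -> 'I_n.+1})%type.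

Definition realized (K : fieldType) (n m : nat) (d : 'I_m -> nat)
    (J : forall j, 'M[K]_(n, d j)) (t : rank_type n m) : Prop :=
  exists k (A : 'M[K]_(k, n)),
    \rank A = t.1 :> nat /\ forall j, \rank (A *m J j) = t.2 j :> nat.

(* The rank inequalities are indexed by the rank types that occur, then come
   [s j >= 0] and [- s j >= -1]. *)
Definition rank_normals (K : fieldType) (n m : nat) (d : 'I_m -> nat)
    (J : forall j, 'M[K]_(n, d j)) (i : rank_type n m + ('I_m + 'I_m)) :
    'I_m -> int :=
  match i with
  | inl t => fun k => if `[< realized J t >] then (t.2 k : nat)%:Z else 0
  | inr (inl j) => fun k => (k == j)%:Z
  | inr (inr j) => fun k => - (k == j)%:Z
  end.

Definition rank_bounds (K : fieldType) (n m : nat) (d : 'I_m -> nat)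
    (J : forall j, 'M[K]_(n, d j)) (i : rank_type n m + ('I_m + 'I_m)) : int :=
  match i with
  | inl t => if `[< realized J t >] then (t.1 : nat)%:Z else 0
  | inr (inl j) => 0
  | inr (inr j) => -1
  end.

Lemma pairing_delta (R : realFieldType) (m : nat) (j : 'I_m) (s : 'I_m -> R) :
  pairing (fun k => (k == j)%:Z) s = s j.
Proof.
rewrite /pairing (bigD1 j)//= eqxx mul1r big1 ?addr0// => k /negPf ->.
by rewrite mul0r.
Qed.

Lemma pairing_opp (R : realFieldType) (m : nat) (g : 'I_m -> int) (s : 'I_m -> R) :
  pairing (fun k => - g k) s = - pairing g s.
Proof. by rewrite /pairing -sumrN; apply: eq_bigr => k _; rewrite mulrNz mulNr. Qed.

Lemma pairing_ranks (R : realFieldType) (m : nat) (r : 'I_m -> nat) (s : 'I_m -> R) :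
  pairing (fun k => (r k)%:Z) s = \sum_j s j * (r j)%:R.
Proof. by rewrite /pairing; apply: eq_bigr => k _; rewrite mulrC -pmulrn. Qed.

Definition rank_type_of (K : fieldType) (n m : nat) (d : 'I_m -> nat)
    (J : forall j, 'M[K]_(n, d j)) (k : nat) (A : 'M[K]_(k, n)) : rank_type n m :=
  (inord (\rank A), [ffun j => inord (\rank (A *m J j))]).

Lemma rank_type_ofE (K : fieldType) (n m : nat) (d : 'I_m -> nat)
    (J : forall j, 'M[K]_(n, d j)) (k : nat) (A : 'M[K]_(k, n)) :
  (rank_type_of J A).1 = \rank A :> nat /\
  forall j, (rank_type_of J A).2 j = \rank (A *m J j) :> nat.
Proof.
split => [|j]; rewrite /= ?ffunE inordK// ltnS ?rank_leq_col//.
by rewrite (leq_trans (mxrankM_maxl _ _))// rank_leq_col.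
Qed.

Lemma rank_type_of_realized (K : fieldType) (n m : nat) (d : 'I_m -> nat)
    (J : forall j, 'M[K]_(n, d j)) (k : nat) (A : 'M[K]_(k, n)) :
  realized J (rank_type_of J A).
Proof. by exists k, A; have [-> h] := rank_type_ofE J A; split. Qed.

Lemma pairing_rank_type (R : realFieldType) (K : fieldType) (n m : nat)
    (d : 'I_m -> nat) (J : forall j, 'M[K]_(n, d j)) (s : 'I_m -> R)
    (k : nat) (A : 'M[K]_(k, n)) :
  pairing (rank_normals J (inl (rank_type_of J A))) s =
    \sum_j s j * (\rank (A *m J j))%:R.
Proof.
rewrite /rank_normals; case: asboolP => [_|[]]; last exact: rank_type_of_realized.
by rewrite pairing_ranks; apply: eq_bigr => j _; have [_ ->] := rank_type_ofE J A.
Qed.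

Lemma rank_bounds_rank_type (K : fieldType) (n m : nat)
    (d : 'I_m -> nat) (J : forall j, 'M[K]_(n, d j)) (k : nat) (A : 'M[K]_(k, n)) :
  rank_bounds J (inl (rank_type_of J A)) = (\rank A)%:Z.
Proof.
rewrite /rank_bounds; case: asboolP => [_|[]]; last exact: rank_type_of_realized.
by have [-> _] := rank_type_ofE J A.
Qed.

Lemma rank_conditionE (R : realFieldType) (K : fieldType) (n m : nat)
    (d : 'I_m -> nat) (J : forall j, 'M[K]_(n, d j)) (s : 'I_m -> R) :
  rank_condition J s <-> feasible (rank_normals J) (rank_bounds J) s.
Proof.
split=> [[s01 sJ] [t|[j|j]]|fs] /=.
- case: asboolP => [|_]; last by rewrite /pairing big1// => k _; rewrite mul0r.
  move=> [k [A [<- rA]]]; rewrite pairing_ranks -pmulrn (le_trans (sJ _ _))//.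
  by apply: ler_sum => j _; rewrite rA.
- by rewrite pairing_delta; case/andP: (s01 j).
- by rewrite pairing_opp pairing_delta lerN2; case/andP: (s01 j).
split=> [j|k A].
  apply/andP; split; first by have := fs (inr (inl j)); rewrite /= pairing_delta.
  by have := fs (inr (inr j)); rewrite /= pairing_opp pairing_delta lerN2.
have := fs (inl (rank_type_of J A)).
by rewrite pairing_rank_type rank_bounds_rank_type -pmulrn.
Qed.

Definition rank_vertex (R : realFieldType) (K : fieldType) (n m : nat)
    (d : 'I_m -> nat) (J : forall j, 'M[K]_(n, d j)) (s : 'I_m -> R) : Prop :=
  vertex (rank_normals J) (rank_bounds J) s.

Lemma rank_vertex_eq0 (R : realFieldType) (K : fieldType) (n m : nat)
    (d : 'I_m -> nat) (J : forall j, 'M[K]_(n, d j)) (s v : 'I_m -> R) :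
  rank_vertex J s -> (forall j, s j = 0 \/ s j = 1 -> v j = 0) ->
  (forall k (A : 'M[K]_(k, n)), (\rank A)%:R = \sum_j s j * (\rank (A *m J j))%:R ->
    \sum_j v j * (\rank (A *m J j))%:R = 0) ->
  forall j, v j = 0.
Proof.
move=> vs v01 vA; apply: vs => -[t|[j|j]]; rewrite inE /=.
- case: asboolP => [|_ _]; last by rewrite /pairing big1// => k _; rewrite mul0r.
  move=> [k [A [<- rA]]]; rewrite !pairing_ranks -pmulrn => /eqP tA.
  rewrite -[RHS](vA k A); first by apply: eq_bigr => j _; rewrite rA.
  by rewrite tA; apply: eq_bigr => j _; rewrite rA.
- by rewrite !pairing_delta eq_sym => /eqP sj; apply: v01; left.
- rewrite !pairing_opp !pairing_delta eqr_opp eq_sym => /eqP sj.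
  by rewrite v01 ?oppr0//; right.
Qed.

Lemma rank_vertex_denominator (R : realFieldType) (K : fieldType) (n m : nat)
    (d : 'I_m -> nat) (J : forall j, 'M[K]_(n, d j)) (s : 'I_m -> R) :
  rank_vertex J s ->
  exists D : nat, (0 < D <= m`! * n.+1 ^ m)%N /\
    forall k, exists z : int, D%:R * s k = z%:~R.
Proof.
apply: vertex_denominator => -[t|[j|j]] k /=.
- by case: asboolP => // _; rewrite absz_nat ltnW// ltnS -ltnS.
- by case: (k == j).
- by case: (k == j).
Qed.

(** The constraints [0 <= s j <= 1] bound the polytope, so [polytope_ind] applies. This reduction to
    vertices serves twice: for the linear inequality and for the passage from [rat] to ['F_p]. *)
Lemma rank_condition_ind (R : realFieldType) (K : fieldType) (n m : nat)
    (d : 'I_m -> nat) (J : forall j, 'M[K]_(n, d j)) (Phi : ('I_m -> R) -> Prop) :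
  (forall (s1 s2 : 'I_m -> R) (t : R),
    rank_condition J s1 -> rank_condition J s2 -> 0 < t < 1 ->
    Phi s1 -> Phi s2 -> Phi (fun k => t * s1 k + (1 - t) * s2 k)) ->
  (forall s, rank_condition J s -> rank_vertex J s -> Phi s) ->
  forall s, rank_condition J s -> Phi s.
Proof.
move=> Phiconv Phivert s /rank_conditionE; apply: polytope_ind.
- move=> v [k /eqP vk]; have [vk0|vk0] := ltP (v k) 0.
    by exists (inr (inl k)); rewrite /= pairing_delta.
  exists (inr (inr k)); rewrite /= pairing_opp pairing_delta oppr_lt0.
  by rewrite lt_neqAle eq_sym vk.
- by move=> s1 s2 t /rank_conditionE ? /rank_conditionE ?; exact: Phiconv.
- by move=> s' /rank_conditionE ?; exact: Phivert.
Qed.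

(** * The linear inequality *)

Lemma ler_sum_fsubset (R : numDomainType) (T : choiceType) (A B : {fset T}) (f : T -> R) :
  (A `<=` B)%fset -> (forall x, 0 <= f x) -> \sum_(x <- A) f x <= \sum_(x <- B) f x.
Proof.
move=> AB f0.
have -> : A = [fset x in B | x \in A]%fset.
  by apply/fsetP => x; rewrite !inE andb_idl//; apply: (fsubsetP AB).
by rewrite big_fset/= big_mkcond; apply: ler_sum => x _; case: ifP.
Qed.

Lemma powR_prod (R : realType) (I : Type) (r : seq I) (F : I -> R) (t : R) :
  (forall i, 0 <= F i) -> (\prod_(i <- r) F i) `^ t = \prod_(i <- r) F i `^ t.
Proof.
move=> F0; elim: r => [|i r IH]; first by rewrite !big_nil powR1.
by rewrite !big_cons powRM ?prodr_ge0// IH.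
Qed.

(** For [a = 0] this relies on 0 to the power 0 being 1: as [t] and [1 - t] are positive, the
    combined exponent vanishes exactly when both [s1] and [s2] do. *)
Lemma powR_convex_exponent (R : realType) (a s1 s2 t : R) :
  0 <= a -> 0 <= s1 -> 0 <= s2 -> 0 < t < 1 ->
  a `^ (t * s1 + (1 - t) * s2) = (a `^ s1) `^ t * (a `^ s2) `^ (1 - t).
Proof.
move=> a0 s10 s20 /andP[t0 t1].
have t1' : 0 < 1 - t by rewrite subr_gt0.
rewrite -!powRrM (mulrC s1) (mulrC s2).
have [->|an0] := eqVneq a 0; last by rewrite powRD// an0 implybT.
have [->|s1n0] := eqVneq s1 0; first by rewrite mulr0 add0r powRr0 mul1r.
have [->|s2n0] := eqVneq s2 0; first by rewrite mulr0 addr0 powRr0 mulr1.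
have ts1 : 0 < t * s1 by rewrite mulr_gt0// lt_neqAle eq_sym s1n0.
have ts2 : 0 < (1 - t) * s2 by rewrite mulr_gt0// lt_neqAle eq_sym s2n0.
by rewrite !powR0 ?mulr0// gt_eqF// addr_gt0.
Qed.

(** Young's inequality with the conjugate exponents [t^-1] and [(1 - t)^-1]. *)
Lemma weighted_AMGM (R : realType) (a b t : R) : 0 <= a -> 0 <= b -> 0 < t < 1 ->
  a `^ t * b `^ (1 - t) <= t * a + (1 - t) * b.
Proof.
move=> a0 b0 /andP[t0 t1].
have t1' : 0 < 1 - t by rewrite subr_gt0.
have /(_ (a `^ t) (b `^ (1 - t))) := @conjugate_powR R _ _ t^-1 (1 - t)^-1.
rewrite !powR_ge0 !invr_gt0 !invrK -!powRrM !mulfV ?gt_eqF// !powRr1//.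
by rewrite (mulrC a) (mulrC b); apply => //; rewrite addrC subrK.
Qed.

(** A discrete Brascamp-Lieb inequality with constant 1. The function [h j] stands for the power
    [1 / s j] of a modulus, which leaves room for the exponent [s j = 0]; the finite sets [E] and
    [T j] keep all sums finite over any field. *)
Definition BL_inequality (R : realType) (K : fieldType) (n m : nat)
    (d : 'I_m -> nat) (J : forall j, 'M[K]_(n, d j)) (s : 'I_m -> R) : Prop :=
  forall (h : forall j, 'rV[K]_(d j) -> R) (T : forall j, {fset 'rV[K]_(d j)})
    (E : {fset 'rV[K]_n}),
  (forall j y, 0 <= h j y) -> (forall x j, x \in E -> x *m J j \in T j) ->
  \sum_(x <- E) \prod_j h j (x *m J j) `^ s j <=
  \prod_j (\sum_(y <- T j) h j y) `^ s j.

(** By homogeneity each [h j] can be divided by its sum [M j]. If [M j = 0] then [h j] vanishes on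
    [T j], and the convention for division by zero gives the right value. *)
Lemma BL_inequality_of_normalized (R : realType) (K : fieldType) (n m : nat)
    (d : 'I_m -> nat) (J : forall j, 'M[K]_(n, d j)) (s : 'I_m -> R) :
  (forall (h : forall j, 'rV[K]_(d j) -> R) (T : forall j, {fset 'rV[K]_(d j)})
      (E : {fset 'rV[K]_n}),
    (forall j y, 0 <= h j y) -> (forall x j, x \in E -> x *m J j \in T j) ->
    (forall j, \sum_(y <- T j) h j y <= 1) ->
    \sum_(x <- E) \prod_j h j (x *m J j) `^ s j <= 1) ->
  BL_inequality J s.
Proof.
move=> norm h T E h0 ET.
pose M j := \sum_(y <- T j) h j y.
have M0 j : 0 <= M j by apply: sumr_ge0.
have hM j y : y \in T j -> h j y = M j * (h j y / M j).
  move=> yT; have [Mj0|Mj0] := eqVneq (M j) 0; last by rewrite mulrCA mulfV ?mulr1.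
  rewrite Mj0 mul0r; apply/eqP; rewrite eq_le h0 andbT -Mj0 /M.
  by rewrite (big_fsetD1 y)//= lerDl sumr_ge0.
have -> : \sum_(x <- E) \prod_j h j (x *m J j) `^ s j =
    \prod_j M j `^ s j * \sum_(x <- E) \prod_j (h j (x *m J j) / M j) `^ s j.
  rewrite mulr_sumr big_seq [RHS]big_seq; apply: eq_bigr => x xE.
  rewrite -big_split; apply: eq_bigr => j _ /=.
  by rewrite {1}hM ?ET// powRM// divr_ge0.
rewrite ler_piMr ?prodr_ge0// => [j _|]; first exact: powR_ge0.
apply: (norm (fun j y => h j y / M j) T) => // [j y|j]; first by rewrite divr_ge0.
rewrite -mulr_suml -/(M j); have [->|Mj0] := eqVneq (M j) 0; first by rewrite mul0r.
by rewrite divff.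
Qed.

(** After normalisation both given inequalities have right-hand side at most 1. Pointwise, the
    summand at the intermediate exponents is a weighted geometric mean of the summands at [s1] and
    [s2], hence at most the corresponding arithmetic mean. *)
Lemma BL_inequality_convex (R : realType) (K : fieldType) (n m : nat)
    (d : 'I_m -> nat) (J : forall j, 'M[K]_(n, d j)) (s1 s2 : 'I_m -> R) (t : R) :
  (forall j, 0 <= s1 j) -> (forall j, 0 <= s2 j) -> 0 < t < 1 ->
  BL_inequality J s1 -> BL_inequality J s2 ->
  BL_inequality J (fun j => t * s1 j + (1 - t) * s2 j).
Proof.
move=> s10 s20 t01 BL1 BL2; apply: BL_inequality_of_normalized => h T E h0 ET T1.
have [t0 t1] := andP t01.
have le1 (s : 'I_m -> R) : (forall j, 0 <= s j) -> BL_inequality J s ->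
    \sum_(x <- E) \prod_j h j (x *m J j) `^ s j <= 1.
  move=> s0 BLs; apply: le_trans (BLs h T E h0 ET) _.
  apply: prodr_ile1 => j _.
  have one : 1 `^ s j = 1 :> R by rewrite powR1.
  rewrite powR_ge0/= -[leRHS]one.
  apply: ge0_ler_powR; rewrite ?nnegrE ?s0 ?T1 ?ler01 ?sumr_ge0//.
apply: (@le_trans _ _ (\sum_(x <- E) (t * \prod_j h j (x *m J j) `^ s1 j +
    (1 - t) * \prod_j h j (x *m J j) `^ s2 j))).
  apply: ler_sum => x _; apply: le_trans (weighted_AMGM _ _ t01).
  - rewrite !powR_prod -?big_split/=; try by move=> j; exact: powR_ge0.
    by rewrite le_eqVlt; apply/orP; left; apply/eqP/eq_bigr => j _;
      rewrite powR_convex_exponent.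
  - by rewrite prodr_ge0// => j _; exact: powR_ge0.
  - by rewrite prodr_ge0// => j _; exact: powR_ge0.
rewrite big_split -!mulr_sumr /= (@le_trans _ _ (t * 1 + (1 - t) * 1))//.
  by rewrite lerD// ler_pM2l ?subr_gt0// le1.
by rewrite !mulr1 addrC subrK.
Qed.

(** Translating by [x0] moves [E] into [V], where the inequality is assumed. The image of [E] under
    [J j] lies in one coset of the image of [V], and [cokermx (V *m J j)] detects that coset, so the
    right-hand side keeps only the points [y] in it. *)
Lemma BL_inequality_fiber (R : realType) (K : fieldType) (n m : nat)
    (d : 'I_m -> nat) (J : forall j, 'M[K]_(n, d j)) (s : 'I_m -> R)
    (V : 'M[K]_n) (x0 : 'rV[K]_n)
    (h : forall j, 'rV[K]_(d j) -> R) (T : forall j, {fset 'rV[K]_(d j)})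
    (E : {fset 'rV[K]_n}) :
  BL_inequality (fun j => row_base V *m J j) s ->
  (forall j y, 0 <= h j y) -> (forall x j, x \in E -> x *m J j \in T j) ->
  (forall x, x \in E -> (x - x0 <= V)%MS) ->
  \sum_(x <- E) \prod_j h j (x *m J j) `^ s j <=
  \prod_j (\sum_(y <- T j | y *m cokermx (V *m J j) ==
                            x0 *m J j *m cokermx (V *m J j)) h j y) `^ s j.
Proof.
move=> BL h0 ET EV.
have /row_freeP[B UB] := row_base_free V.
pose phi x := (x - x0) *m B.
have phiK x : x \in E -> phi x *m row_base V = x - x0.
  move=> /EV; rewrite -(eq_row_base V) => /submxP[D xD].
  by rewrite /phi xD -(mulmxA D) UB mulmx1.
have phiJ x j : x \in E -> phi x *m (row_base V *m J j) = (x - x0) *m J j.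
  by move=> xE; rewrite mulmxA phiK.
pose T1 j := [fset y in T j | y *m cokermx (V *m J j) == x0 *m J j *m cokermx (V *m J j)]%fset.
have := BL (fun j y => h j (x0 *m J j + y)) (fun j => [fset y - x0 *m J j | y in T1 j]%fset)
  [fset phi x | x in E]%fset (fun j y => h0 _ _).
have -> : \sum_(x <- [fset phi x | x in E]%fset)
     \prod_j h j (x0 *m J j + x *m (row_base V *m J j)) `^ s j =
     \sum_(x <- E) \prod_j h j (x *m J j) `^ s j.
  rewrite big_imfset/=; last first.
    by move=> x y xE yE xy; apply: (addIr (- x0)); rewrite -!phiK// xy.
  rewrite big_seq [RHS]big_seq; apply: eq_bigr => x xE; apply: eq_bigr => j _.
  by rewrite phiJ// mulmxBl addrC subrK.
have -> : \prod_j (\sum_(y <- [fset y - x0 *m J j | y in T1 j]%fset) h j (x0 *m J j + y)) `^ s j =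
   \prod_j (\sum_(y <- T j | y *m cokermx (V *m J j) ==
                             x0 *m J j *m cokermx (V *m J j)) h j y) `^ s j.
  apply: eq_bigr => j _; congr (_ `^ _).
  rewrite big_imfset/=; last by move=> ? ? _ _ /addIr.
  rewrite /T1 big_fset/=; apply: eq_bigr => y _; by rewrite addrC subrK.
apply=> _ j /imfsetP[x /= xE ->]; rewrite phiJ//.
apply/imfsetP; exists (x *m J j); rewrite ?mulmxBl//= !inE ET//=.
rewrite -subr_eq0 -mulmxBl -mulmxBl; have /submxP[D ->] := EV x xE.
by rewrite -(mulmxA D) -(mulmxA D) mulmx_coker mulmx0.
Qed.

(** Fubini for [V] and its quotient, with projection [Q] and section [C]. On each fibre of [Q] the
    inequality on [V] produces the sums [H j] of [h j] over cosets of the image of [V]; the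
    inequality on the quotient is then applied to the [H j]. *)
Lemma BL_inequality_split (R : realType) (K : fieldType) (n m : nat)
    (d : 'I_m -> nat) (J : forall j, 'M[K]_(n, d j)) (s : 'I_m -> R)
    (V : 'M[K]_n) (l : nat) (Q : 'M[K]_(n, l)) (C : 'M[K]_(l, n)) :
  (forall j, 0 <= s j) ->
  C *m Q = 1%:M -> (forall x : 'rV[K]_n, x *m Q = 0 -> (x <= V)%MS) ->
  BL_inequality (fun j => row_base V *m J j) s ->
  BL_inequality (fun j => C *m J j *m cokermx (V *m J j)) s ->
  BL_inequality J s.
Proof.
move=> s0 CQ QV BLV BLQ h T E h0 ET.
pose H j w := \sum_(y <- T j | y *m cokermx (V *m J j) == w) h j y.
have H0 j w : 0 <= H j w by exact: sumr_ge0.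
rewrite (partition_big_imfset _ (fun x => x *m Q)).
apply: (@le_trans _ _ (\sum_(z <- [fset x *m Q | x in E]%fset)
    \prod_j H j (z *m (C *m J j *m cokermx (V *m J j))) `^ s j)).
  rewrite big_seq [leRHS]big_seq; apply: ler_sum => _ /imfsetP[x0 /= x0E ->].
  have := @BL_inequality_fiber R K n m d J s V x0 h T
    [fset x in E | x *m Q == x0 *m Q]%fset BLV h0.
  rewrite big_fset/=.
  have -> : \prod_j (\sum_(y <- T j | y *m cokermx (V *m J j) ==
      x0 *m J j *m cokermx (V *m J j)) h j y) `^ s j =
      \prod_j H j (x0 *m Q *m (C *m J j *m cokermx (V *m J j))) `^ s j.
    apply: eq_bigr => j _; rewrite /H; congr ((bigop.body _ _ _) `^ _).
    (* A point and the chosen lift of its class differ by an element of [V], so their images under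
       [J j] lie in the same coset. *)
    have : (x0 - x0 *m Q *m C <= V)%MS.
      by apply: QV; rewrite mulmxBl -(mulmxA _ C) CQ mulmx1 subrr.
    move=> /submxP[D xD].
    have : (x0 - x0 *m Q *m C) *m J j *m cokermx (V *m J j) = 0.
      by rewrite xD -(mulmxA D) -(mulmxA D) mulmx_coker mulmx0.
    by rewrite !mulmxBl => /subr0_eq ->; rewrite !mulmxA.
  apply=> [x j|x]; rewrite !inE => /andP[xE /eqP xQ]; first exact: ET.
  by apply: QV; rewrite mulmxBl xQ subrr.
apply: le_trans (BLQ H (fun j => [fset y *m cokermx (V *m J j) | y in T j]%fset) _ H0 _) _.
  move=> _ j /imfsetP[x /= xE ->]; apply/imfsetP; exists (x *m J j) => //=.
    exact: ET.
  have : (x - x *m Q *m C <= V)%MS.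
    by apply: QV; rewrite mulmxBl -(mulmxA _ C) CQ mulmx1 subrr.
  move=> /submxP[D xD].
  have : (x - x *m Q *m C) *m J j *m cokermx (V *m J j) = 0.
    by rewrite xD -(mulmxA D) -(mulmxA D) mulmx_coker mulmx0.
  by rewrite !mulmxBl => /subr0_eq ->; rewrite !mulmxA.
by rewrite le_eqVlt; apply/orP; left; apply/eqP/eq_bigr => j _;
  rewrite [in RHS](partition_big_imfset _ (fun y => y *m cokermx (V *m J j))).
Qed.

(** On a fibre of [J i] the factor [h i] is constant and comes out of the sum to the first power.
    The other factors are bounded uniformly in the fibre by the inequality on the kernel, and
    summing [h i] over the fibres gives its own factor. *)
Lemma BL_inequality_exponent1 (R : realType) (K : fieldType) (n m : nat)
    (d : 'I_m -> nat) (J : forall j, 'M[K]_(n, d j)) (s : 'I_m -> R) (i : 'I_m) :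
  (forall j, 0 <= s j) -> s i = 1 ->
  BL_inequality (fun j => row_base (kermx (J i)) *m J j)
    (fun j => if j == i then 0 else s j) ->
  BL_inequality J s.
Proof.
move=> s0 si BLi h T E h0 ET.
pose s' j := if j == i then 0 else s j.
have s'0 j : 0 <= s' j by rewrite /s'; case: ifP.
rewrite (partition_big_imfset _ (fun x => x *m J i)).
apply: (@le_trans _ _ (\sum_(z <- [fset x *m J i | x in E]%fset)
    h i z * \prod_j (\sum_(y <- T j) h j y) `^ s' j)).
  rewrite big_seq [leRHS]big_seq; apply: ler_sum => _ /imfsetP[x0 /= x0E ->].
  have -> : \sum_(x <- E | x *m J i == x0 *m J i) \prod_j h j (x *m J j) `^ s j =
      h i (x0 *m J i) *
      \sum_(x <- [fset x in E | x *m J i == x0 *m J i]%fset) \prod_j h j (x *m J j) `^ s' j.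
    rewrite big_fset/= mulr_sumr; apply: eq_bigr => x /eqP xi.
    rewrite (bigD1 i)//= [in RHS](bigD1 i)//= si /s' eqxx powRr1// powRr0 mul1r xi.
    by congr (_ * _); apply: eq_bigr => j /negPf ->.
  rewrite ler_wpM2l//.
  apply: le_trans (@BL_inequality_fiber R K n m d J s' (kermx (J i)) x0 h T _ BLi h0 _ _) _.
  - by move=> x j; rewrite !inE => /andP[xE _]; exact: ET.
  - move=> x; rewrite !inE => /andP[xE /eqP xi].
    by apply/sub_kermxP; rewrite mulmxBl xi subrr.
  apply: ler_prod => j _; rewrite powR_ge0/=; apply: ge0_ler_powR => //.
  - by rewrite nnegrE sumr_ge0.
  - by rewrite nnegrE sumr_ge0.
  by rewrite big_mkcond; apply: ler_sum => y _; case: ifP.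
rewrite -mulr_suml [leRHS](bigD1 i)//= si powRr1 ?sumr_ge0//.
rewrite [X in _ * X](bigD1 i)//= {1}/s' eqxx powRr0 mul1r.
have -> : \prod_(j < m | j != i) (\sum_(y <- T j) h j y) `^ s' j =
          \prod_(j < m | j != i) (\sum_(y <- T j) h j y) `^ s j.
  by apply: eq_bigr => j /negPf ji; rewrite /s' ji.
rewrite ler_wpM2r ?prodr_ge0// => [j _|]; first exact: powR_ge0.
apply: ler_sum_fsubset => //; apply/fsubsetP => _ /imfsetP[x /= xE ->].
exact: ET.
Qed.

(** Rank-nullity for the projection modulo [Y], restricted to the sum of the two row spaces. *)
Lemma mxrank_col_mx_coker (K : fieldType) (k l n : nat)
    (X : 'M[K]_(k, n)) (Y : 'M[K]_(l, n)) :
  \rank (col_mx X Y) = (\rank (X *m cokermx Y) + \rank Y)%N.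
Proof.
rewrite -(mxrank_mul_ker (col_mx X Y) (cokermx Y)) mul_col_mx mulmx_coker.
rewrite rank_col_mx0; congr addn.
have kerY : (kermx (cokermx Y) <= Y)%MS by rewrite submxE mulmx_ker.
have Yker : (Y <= kermx (cokermx Y))%MS by apply/sub_kermxP; rewrite mulmx_coker.
have YXY : (Y <= col_mx X Y)%MS by rewrite -addsmxE addsmxSr.
apply: eqmx_rank; rewrite /eqmx sub_capmx YXY Yker !andbT.
by rewrite (submx_trans (capmxSr _ _)).
Qed.

Lemma BL_inequality_dim0 (R : realType) (K : fieldType) (m : nat)
    (d : 'I_m -> nat) (J : forall j, 'M[K]_(0, d j)) (s : 'I_m -> R) :
  (forall j, 0 <= s j) -> BL_inequality J s.
Proof.
move=> s0 h T E h0 ET.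
have [->|[x xE]] := fset_0Vmem E.
  by rewrite big_seq_fset0 prodr_ge0// => j _; exact: powR_ge0.
have -> : E = [fset x]%fset.
  by apply/fsetP => y; rewrite inE (thinmx0 y) -(thinmx0 x) eqxx xE.
rewrite big_seq_fset1; apply: ler_prod => j _; rewrite powR_ge0/=.
apply: ge0_ler_powR; rewrite ?nnegrE ?sumr_ge0//.
by rewrite (big_fsetD1 (x *m J j)) ?ET//= lerDl sumr_ge0.
Qed.

Lemma rank_condition_sub (R : realFieldType) (K : fieldType) (n m : nat)
    (d : 'I_m -> nat) (J : forall j, 'M[K]_(n, d j)) (s : 'I_m -> R) (V : 'M[K]_n) :
  rank_condition J s -> rank_condition (fun j => row_base V *m J j) s.
Proof.
move=> [s01 sJ]; split=> // k A.
have := sJ _ (A *m row_base V); rewrite mxrankMfree ?row_base_free// => /le_trans -> //.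
by apply: ler_sum => j _; rewrite mulmxA.
Qed.

(** The [i]-th image of a subspace of the kernel is zero, so its weight can be changed to 0. *)
Lemma rank_condition_kernel (R : realFieldType) (K : fieldType) (n m : nat)
    (d : 'I_m -> nat) (J : forall j, 'M[K]_(n, d j)) (s : 'I_m -> R) (i : 'I_m) :
  rank_condition J s ->
  rank_condition (fun j => row_base (kermx (J i)) *m J j)
    (fun j => if j == i then 0 else s j).
Proof.
move=> sJ; have [s01 sV] := rank_condition_sub (kermx (J i)) sJ; split=> [j|k A].
  by case: ifP; rewrite ?lexx ?ler01.
apply: le_trans (sV k A) _; apply: ler_sum => j _; case: eqP => // ->.
have -> : row_base (kermx (J i)) *m J i = 0.
  by apply/sub_kermxP; rewrite eq_row_base.
by rewrite mulmx0 mxrank0 !mulr0.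
Qed.

(** A subspace of the quotient is lifted and added to [V]; the rank inequality for this sum, minus
    the equality for [V], is the inequality sought. *)
Lemma rank_condition_quotient (R : realFieldType) (K : fieldType) (n m : nat)
    (d : 'I_m -> nat) (J : forall j, 'M[K]_(n, d j)) (s : 'I_m -> R) (V : 'M[K]_n)
    (C : 'M[K]_(\rank (cokermx V), n)) :
  C *m col_base (cokermx V) = 1%:M ->
  (\rank V)%:R = \sum_j s j * (\rank (V *m J j))%:R ->
  rank_condition J s ->
  rank_condition (fun j => C *m J j *m cokermx (V *m J j)) s.
Proof.
move=> CQ sV [s01 sJ]; split=> // k A.
have := sJ _ (col_mx (A *m C) V); rewrite mxrank_col_mx_coker.
have -> : \rank (A *m C *m cokermx V) = \rank A.
  have -> : A *m C *m cokermx V = A *m row_base (cokermx V).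
    rewrite -[X in A *m C *m X](mulmx_base (cokermx V)) mulmxA -(mulmxA A) CQ.
    by rewrite mulmx1.
  by rewrite mxrankMfree// row_base_free.
have -> : \sum_j s j * (\rank (col_mx (A *m C) V *m J j))%:R =
    \sum_j s j * (\rank (A *m (C *m J j *m cokermx (V *m J j))))%:R +
    \sum_j s j * (\rank (V *m J j))%:R.
  rewrite -big_split; apply: eq_bigr => j _ /=.
  by rewrite mul_col_mx mxrank_col_mx_coker natrD mulrDr !mulmxA.
by rewrite natrD -sV lerD2r.
Qed.

(** If both alternatives fail, the tight constraints are among [s l = 0], [s l = 1] with [J l = 0],
    and those of the zero and full spaces. The full space gives n at most the sum of the
    [s j * r j], while each single term is below n. So two terms are nonzero, and their weights can
    be traded against each other, which a vertex forbids. *)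
Lemma rank_vertex_split (R : realFieldType) (K : fieldType) (n m : nat)
    (d : 'I_m -> nat) (J : forall j, 'M[K]_(n, d j)) (s : 'I_m -> R) :
  (0 < n)%N -> rank_condition J s -> rank_vertex J s ->
  (exists i, s i = 1 /\ J i != 0) \/
  exists V : 'M[K]_n, (0 < \rank V < n)%N /\
    (\rank V)%:R = \sum_j s j * (\rank (V *m J j))%:R.
Proof.
move=> n0 [s01 sJ] vs; apply: contrapT => /not_orP[no1 nocrit].
have lt1 i : J i != 0 -> s i < 1.
  move=> Ji; rewrite lt_neqAle; have /andP[_ ->] := s01 i; rewrite andbT.
  by apply/eqP => si; apply: no1; exists i.
pose r j := \rank (J j).
have sn : n%:R <= \sum_j s j * (r j)%:R.
  have := sJ _ (1%:M : 'M[K]_n); rewrite mxrank1 => /le_trans -> //.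
  by apply: ler_sum => j _; rewrite mul1mx.
have single i : s i * (r i)%:R < n%:R.
  have [Ji|Ji] := eqVneq (J i) 0; first by rewrite /r Ji mxrank0 mulr0 ltr0n.
  have ri : (0 < r i)%N by rewrite lt0n mxrank_eq0.
  apply: (@lt_le_trans _ _ (r i)%:R); last by rewrite ler_nat rank_leq_row.
  by rewrite gtr_pMl ?lt1// ltr0n.
have [i si] : exists i, s i * (r i)%:R != 0.
  apply: contrapT => /forallNP no; move: sn; rewrite leNgt big1 ?ltr0n ?n0// => i _.
  by apply/eqP/negPn/negP; exact: no.
have [k ki sk] : exists2 k, k != i & s k * (r k)%:R != 0.
  apply: contrapT => no; move: sn; rewrite leNgt (bigD1 i)//= big1 ?addr0 ?single//.
  by move=> k ki; apply/eqP/negPn/negP => sk; apply: no; exists k.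
have [si0 ri0] : s i != 0 /\ (r i)%:R != 0 :> R.
  by move: si; rewrite mulf_eq0 negb_or => /andP.
have [sk0 rk0] : s k != 0 /\ (r k)%:R != 0 :> R.
  by move: sk; rewrite mulf_eq0 negb_or => /andP.
have Jn0 l : (r l)%:R != 0 :> R -> J l != 0.
  by rewrite pnatr_eq0 -mxrank_eq0.
(* This direction moves only two weights lying strictly between 0 and 1, and it preserves the sum of
   the [s l * r l]. *)
pose v l : R := if l == i then (r k)%:R else if l == k then - (r i)%:R else 0.
have := @rank_vertex_eq0 R K n m d J s v vs _ _ i; rewrite /v eqxx => H.
move/eqP: (rk0); apply; apply: H => [l sl|p A crit].
  have [li|_] := eqVneq l i.
    by subst l; case: sl => sl; [move/eqP: si0|have := lt1 i (Jn0 i ri0); rewrite sl ltxx].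
  have [lk|//] := eqVneq l k.
  by subst l; case: sl => sl; [move/eqP: sk0|have := lt1 k (Jn0 k rk0); rewrite sl ltxx].
have sumv (f : 'I_m -> R) : \sum_l (if l == i then (r k)%:R
    else if l == k then - (r i)%:R else 0) * f l = (r k)%:R * f i - (r i)%:R * f k.
  rewrite (bigD1 i)//= eqxx (bigD1 k)//= (negPf ki) eqxx big1 ?addr0 ?mulNr//.
  by move=> l /andP[/negPf -> /negPf ->]; rewrite mul0r.
rewrite sumv.
have [A0|A0] := posnP (\rank A).
  by move/eqP: A0; rewrite mxrank_eq0 => /eqP ->; rewrite !mul0mx !mxrank0 !mulr0 subr0.
have [An|An] := ltnP (\rank A) n.
  exfalso; apply: nocrit; exists <<A>>%MS; rewrite !genmxE; split; first by rewrite A0.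
  by rewrite crit; apply: eq_bigr => j _; rewrite (eqmxMr _ (genmxE A)).
have Afull : row_full A by rewrite -col_leq_rank.
by rewrite !(eqmxMfull _ Afull) mulrC subrr.
Qed.

(** Strong induction on [n]: the kernel of a nonzero [J i], or a proper nonzero [V] and its
    quotient, have smaller dimension. *)
Theorem BL_inequality_linear (R : realType) (K : fieldType) (n m : nat)
    (d : 'I_m -> nat) (J : forall j, 'M[K]_(n, d j)) (s : 'I_m -> R) :
  rank_condition J s -> BL_inequality J s.
Proof.
have [N] := ubnP n; elim: N n J s => // N IH n J s nN.
move: s; apply: rank_condition_ind => [s1 s2 t sJ1 sJ2 t01|s sJ vs].
  by apply: BL_inequality_convex => // j; [case: sJ1|case: sJ2] => /(_ j)/andP[].
have s0 j : 0 <= s j by case: sJ => /(_ j)/andP[].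
have [n0|n0] := posnP n.
  by subst n; exact: BL_inequality_dim0.
have [[i [si Ji]]|[V [/andP[V0 Vn] sV]]] := rank_vertex_split n0 sJ vs.
  apply: (BL_inequality_exponent1 s0 si); apply: IH.
    have ri : (0 < \rank (J i))%N by rewrite lt0n mxrank_eq0.
    by have := rank_leq_row (J i); rewrite mxrank_ker; lia.
  exact: rank_condition_kernel.
have /row_fullP[C CQ] := col_base_full (cokermx V).
apply: (@BL_inequality_split _ _ _ _ _ _ _ V _ _ _ s0 CQ).
- move=> x xQ; have : x *m (col_base (cokermx V) *m row_base (cokermx V)) = 0.
    by rewrite mulmxA xQ mul0mx.
  by rewrite mulmx_base submxE => ->.
- apply: IH; last exact: rank_condition_sub.
  exact: leq_trans Vn nN.
- apply: IH; last exact: rank_condition_quotient.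
  by rewrite mxrank_coker; lia.
Qed.

(** * Reduction of the rank condition modulo a large prime *)

Lemma Fp_lift_bound (p : nat) (w : 'F_p) : prime p -> (nat_of_ord w < p)%N.
Proof. by move=> pp; rewrite -{2}(Fp_cast pp) ltn_ord. Qed.

Lemma Fp_liftK (p : nat) (w : 'F_p) : ((nat_of_ord w)%:Z)%:~R = w.
Proof. by rewrite -pmulrn natr_Zp. Qed.

Definition Fp_lift (p k n : nat) (A : 'M['F_p]_(k, n)) : 'M[int]_(k, n) :=
  map_mx (fun w : 'F_p => (nat_of_ord w)%:Z) A.

Lemma map_Fp_lift (p k n : nat) (A : 'M['F_p]_(k, n)) :
  map_mx intr (Fp_lift A) = A :> 'M['F_p]_(k, n).
Proof. by apply/matrixP => i j; rewrite !mxE Fp_liftK. Qed.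

Lemma map_intr_inj (k n : nat) :
  injective (fun A : 'M[int]_(k, n) => map_mx intr A : 'M[rat]_(k, n)).
Proof.
move=> A B /matrixP AB; apply/matrixP => i j.
by have := AB i j; rewrite !mxE => /intr_inj.
Qed.

(* A point of the box is determined by its residue, which lies in the row space
   of [U], and by its quotient by [p], which takes at most [2 C] values per
   coordinate. *)
Lemma card_box_residues (p r e C : nat) (U : 'M['F_p]_(r, e))
    (T : {fset 'rV[int]_e}) :
  prime p ->
  (forall y, y \in T -> exists w : 'rV['F_p]_r, map_mx intr y = w *m U) ->
  (forall y k, y \in T -> (`|y 0%R k| + p <= C * p)%N) ->
  (#|` T| <= p ^ r * C.*2 ^ e)%N.
Proof.
move=> pp TU TC.
(* The quotient by [p] lies between [- C] and [C - 1]; it is stored shifted by [C]. *)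
pose g (t : 'rV['F_p]_r * {ffun 'I_e -> 'I_C.*2}) : 'rV[int]_e :=
  \row_k ((nat_of_ord ((t.1 *m U) 0 k))%:Z + p%:Z * ((t.2 k : nat)%:Z - C%:Z)).
have TG : (T `<=` [fset g t | t in {: 'rV['F_p]_r * {ffun 'I_e -> 'I_C.*2}}])%fset.
  apply/fsubsetP => y yT; have [w yw] := TU y yT.
  pose q k := divz (y 0 k - (nat_of_ord ((w *m U) 0 k))%:Z) p%:Z.
  have qE k : y 0 k = (nat_of_ord ((w *m U) 0 k))%:Z + p%:Z * q k.
    rewrite /q mulrC divzK; first by rewrite addrC subrK.
    rewrite (dvdz_pcharf (pchar_Fp pp)) rmorphB /= Fp_liftK subr_eq0.
    by move/rowP: yw => /(_ k); rewrite !mxE => ->.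
  have qC k : (`|(q k + C%:Z)%R| < C.*2)%N.
    have := TC y k yT; have := Fp_lift_bound ((w *m U) 0 k) pp.
    move: (qE k) (prime_gt0 pp); move: (nat_of_ord _) (q k) (y 0 k) => a b z.
    by nia.
  apply/imfsetP; exists (w, [ffun k => Ordinal (qC k)]) => //=.
  apply/rowP => k; rewrite mxE ffunE /= {1}(qE k); congr (_ + _ * _).
  have := TC y k yT; have := Fp_lift_bound ((w *m U) 0 k) pp.
  move: (qE k) (prime_gt0 pp); move: (nat_of_ord _) (q k) (y 0 k) => a b z.
  by nia.
apply: leq_trans (fsubset_leq_card TG) _; apply: leq_trans (leq_imfset_card _ _ _) _.
by rewrite -cardT card_prod card_mx card_Fp// mul1n card_ffun !card_ord.
Qed.

Lemma absz_sum_le (I : finType) (F : I -> int) (B : nat) :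
  (forall i, `|F i|%N <= B)%N -> (`|(\sum_i F i)%R|%N <= #|I| * B)%N.
Proof.
move=> FB; rewrite -lez_nat abszE; apply: le_trans (ler_norm_sum _ _ _) _.
apply: (@le_trans _ _ (\sum_(i : I) B%:Z)).
  by apply: ler_sum => i _; rewrite -abszE lez_nat FB.
by rewrite sumr_const PoszM -mulr_natl natz.
Qed.

(* The linear inequality over [rat], applied to the canonical lifts of the
   points of the row space of [A]. *)
Lemma card_rowspace_le (R : realType) (n m : nat) (d : 'I_m -> nat)
    (J : forall j, 'M[int]_(n, d j)) (s : 'I_m -> R) (c p k : nat)
    (A : 'M['F_p]_(k, n)) :
  prime p -> (forall j i l, `|J j i l|%N <= c)%N ->
  rank_condition (fun j => map_mx intr (J j) : 'M[rat]_(n, d j)) s ->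
  (p ^ \rank A)%:R <=
  \prod_j ((p ^ \rank (A *m map_mx intr (J j)) * (n * c).+1.*2 ^ d j)%N%:R : R) `^ s j.
Proof.
move=> pp Jc sJ.
pose f (u : 'rV['F_p]_(\rank A)) := Fp_lift (u *m row_base A).
have f_inj : injective f.
  move=> u v /(congr1 (map_mx (intr : int -> 'F_p))); rewrite !map_Fp_lift.
  by apply: row_free_inj; exact: row_base_free.
pose E := [fset f u | u in {: 'rV['F_p]_(\rank A)}]%fset.
pose T j := [fset x *m J j | x in E]%fset.
(* Lifted entries are at most [p - 1], so coordinates of the images are at most [n * c * (p - 1)] in
   absolute value; adding [p] stays within [(n * c).+1 * p]. *)
have ET j : (#|` T j| <= p ^ \rank (A *m map_mx intr (J j)) * (n * c).+1.*2 ^ d j)%N.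
  apply: (@card_box_residues p _ _ _ (row_base (A *m map_mx intr (J j)))) => //.
    move=> _ /imfsetP[_ /imfsetP[u _ ->] ->].
    apply/submxP; rewrite eq_row_base map_mxM /f map_Fp_lift -mulmxA.
    by rewrite mulmx_sub// submxMr// eq_row_base.
  move=> _ l /imfsetP[_ /imfsetP[u _ ->] ->]; rewrite mxE.
  have : (`|(\sum_i f u 0 i * J j i l)%R| <= #|'I_n| * (p.-1 * c))%N.
    apply: absz_sum_le => i; rewrite abszM leq_mul ?Jc// mxE absz_nat.
    by rewrite -ltnS prednK ?prime_gt0// Fp_lift_bound.
  rewrite card_ord mulSn addnC leq_add2l => /leq_trans -> //.
  by rewrite (mulnC p.-1) mulnA leq_mul2l leq_pred orbT.
have := BL_inequality_linear sJ.
move=> /(_ (fun _ _ => 1) (fun j => [fset map_mx intr x | x in T j]%fset)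
  [fset map_mx intr x | x in E]%fset (fun _ _ => ler01)).
have prod1 : \prod_j (1 : R) `^ s j = 1 by rewrite big1// => j _; rewrite powR1.
rewrite prod1.
rewrite -(natr_sum _ _ _ (fun=> 1%N)) -card_fset_sum1.
rewrite card_imfset/=; last exact: map_intr_inj.
rewrite card_imfset//= -cardT card_mx card_Fp// mul1n => BL.
apply: le_trans (BL _) _.
  move=> _ j /imfsetP[x /= xE ->]; apply/imfsetP; exists (x *m J j).
    by apply/imfsetP; exists x.
  by rewrite map_mxM.
apply: ler_prod => j _; rewrite powR_ge0/=; apply: ge0_ler_powR.
- by case: sJ => /(_ j)/andP[].
- by rewrite nnegrE sumr_ge0.
- by rewrite nnegrE.
rewrite -(natr_sum _ _ _ (fun=> 1%N)) -card_fset_sum1 ler_nat.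
apply: leq_trans (ET j); exact: leq_imfset_card.
Qed.

(** Raising to the power [D] clears the denominators of the weights, which turns real inequalities
    into inequalities between natural numbers. *)
Lemma powR_prod_natr (R : realType) (m : nat) (b : 'I_m -> nat) (s : 'I_m -> R)
    (D : nat) (a : 'I_m -> nat) :
  (forall j, D%:R * s j = (a j)%:R) ->
  (\prod_j ((b j)%:R : R) `^ s j) ^+ D = (\prod_j b j ^ a j)%N%:R.
Proof.
move=> sa; rewrite -prodrXl natr_prod; apply: eq_bigr => j _.
by rewrite -powR_mulrn ?powR_ge0// -powRrM mulrC sa powR_mulrn// natrX.
Qed.

(* At a vertex of the polytope the weights have a bounded denominator [D]. A
   subspace of ['F_p^n] violating the condition there violates it by at least
   [1 / D], which [card_rowspace_le] rules out for large [p]. *)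
Theorem rank_condition_Fp (R : realType) (n m : nat) (d : 'I_m -> nat)
    (J : forall j, 'M[int]_(n, d j)) (s : 'I_m -> R) (c p : nat) :
  prime p -> (forall j i l, `|J j i l|%N <= c)%N ->
  ((n * c).+1.*2 ^ ((\sum_j d j) * (m`! * n.+1 ^ m)) < p)%N ->
  rank_condition (fun j => map_mx intr (J j) : 'M[rat]_(n, d j)) s ->
  rank_condition (fun j => map_mx intr (J j) : 'M['F_p]_(n, d j)) s.
Proof.
move=> pp Jc pbig; move: s.
apply: rank_condition_ind => [s1 s2 t _ _ /andP[t0 t1] [s101 s1J] [s201 s2J]|s sJ vs].
  have t1' : 0 < 1 - t by rewrite subr_gt0.
  have tt : t + (1 - t) = 1 by rewrite addrC subrK.
  split=> [j|k A].
    have /andP[s10 s11] := s101 j; have /andP[s20 s21] := s201 j.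
    by apply/andP; split; nra.
  have := s1J k A; have := s2J k A.
  under [X in _ -> _ -> _ <= X]eq_bigr do rewrite mulrDl -!mulrA.
  by rewrite big_split -!mulr_sumr /=; nra.
have [s01 _] := sJ; split=> // k A.
have [D [/andP[D0 Dle] sD]] := rank_vertex_denominator vs.
have /choice[a sa] : forall j, exists a : nat, D%:R * s j = a%:R.
  move=> j; have [z sz] := sD j; exists `|z|%N; rewrite sz natr_absz ger0_norm//.
  by rewrite -(ler0z R) -sz mulr_ge0//; case/andP: (s01 j).
have aD j : (a j <= D)%N.
  by rewrite -(ler_nat R) -sa ger_pMr ?ltr0n//; case/andP: (s01 j).
rewrite leNgt; apply/negP => viol.
pose r j := \rank (A *m map_mx intr (J j) : 'M['F_p]_(k, d j)).
pose B := (n * c).+1.*2.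
(* Both sides are integers, so a strict violation leaves a gap of at least 1 in the exponent, that
   is, a whole factor [p]. *)
have ranks : (\sum_j a j * r j < D * \rank A)%N.
  rewrite -(ltr_nat R) natrM natr_sum; apply: le_lt_trans (_ : _ <= D%:R * _) _; last first.
    by rewrite ltr_pM2l ?ltr0n//; exact: viol.
  by rewrite mulr_sumr; apply: ler_sum => j _; rewrite natrM -sa mulrA.
have := card_rowspace_le A pp Jc sJ => /(lerXn2r D).
rewrite !nnegrE ler0n => /(_ isT) => H.
have {H} := H (prodr_ge0 _ (fun j _ => powR_ge0 _ _)).
rewrite (powR_prod_natr _ sa) -natrX ler_nat -/B.
under eq_bigr do rewrite expnMn.
rewrite big_split/= -!expnM.
under eq_bigr do rewrite -expnM mulnC.
rewrite -expn_sum mulnC => H.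
(* As [a j <= D] and [D] is bounded uniformly over the vertices, the accumulated constant is smaller
   than that spare factor [p]. *)
have B2 : (\prod_j (B ^ d j) ^ a j <= B ^ ((\sum_j d j) * (m`! * n.+1 ^ m)))%N.
  under eq_bigr do rewrite -expnM.
  rewrite -expn_sum leq_exp2l ?/B ?doubleS// big_distrl/=.
  by apply: leq_sum => j _; rewrite leq_mul2l (leq_trans (aD j))// orbT.
have := leq_trans H (leq_mul (leqnn _) B2).
apply/negP; rewrite -ltnNge; apply: (@leq_trans (p ^ (\sum_j a j * r j).+1)).
  by rewrite expnSr ltn_pmul2l// expn_gt0 prime_gt0.
by rewrite leq_exp2l ?prime_gt1.
Qed.

(** * Induction on scales *)

Lemma mpoly_ring_ind (n : nat) (R : comNzRingType) (Pr : mpoly.mpoly n R -> Prop) :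
  (forall c, Pr (mpoly.mpolyC n c)) ->
  (forall i, Pr (mpoly.mpolyX R (mpoly.mnm1 i))) ->
  (forall f g, Pr f -> Pr g -> Pr (f + g)) ->
  (forall f g, Pr f -> Pr g -> Pr (f * g)) ->
  forall f, Pr f.
Proof.
move=> PC PX PD PM f; elim/mpoly.mpolyind: f => [|c m f _ _ Pf].
  by rewrite -mpoly.mpolyC0.
apply: (PD) => //; rewrite -mpoly.mul_mpolyC; apply: (PM) => //.
rewrite mpoly.mpolyXE_id.
apply: (big_ind Pr) => //; first exact: (PC 1).
move=> i _; elim: (m i) => [|e IH]; first exact: (PC 1).
by rewrite exprS; apply: PM.
Qed.

(** The remainder [w] lies in the ring itself, so divisibility can be read off over the integers.
    The property passes through sums and products, by the Leibniz rule. *)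
Lemma meval_taylor (n : nat) (R : comNzRingType) (f : mpoly.mpoly n R)
    (x y : 'I_n -> R) (t : R) :
  exists w, mpoly.meval (fun i => x i + t * y i) f =
    mpoly.meval x f + t * (\sum_l mpoly.meval x (mpoly.mderiv l f) * y l) + t ^+ 2 * w.
Proof.
elim/mpoly_ring_ind: f => [c|i|f g [u fu] [v gv]|f g [u fu] [v gv]].
- exists 0; rewrite !mpoly.mevalC big1 ?mulr0 ?addr0// => l _.
  by rewrite mpoly.mderivC mpoly.meval0 mul0r.
- exists 0; rewrite !mpoly.mevalXU (bigD1 i)//= big1 => [|l li].
    rewrite mpoly.mderivX mpoly.mevalZ mpoly.mnm1E eqxx mul1r.
    have -> : mpoly.mnm_sub (mpoly.mnm1 i) (mpoly.mnm1 i) = mpoly.mnm0.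
      by apply/mpoly.mnmP => l; rewrite mpoly.mnmBE mpoly.mnm0E subnn.
    by rewrite mpoly.mpolyX0 mpoly.meval1 mul1r mulr0 !addr0.
  by rewrite mpoly.mderivX mpoly.mnm1E eq_sym (negPf li) scale0r mpoly.meval0 mul0r.
- exists (u + v); rewrite !mpoly.mevalD fu gv.
  under [in RHS]eq_bigr do rewrite mpoly.mderivD mpoly.mevalD mulrDl.
  by rewrite big_split /=; ring.
- pose F := \sum_l mpoly.meval x (mpoly.mderiv l f) * y l.
  pose G := \sum_l mpoly.meval x (mpoly.mderiv l g) * y l.
  (* The terms divisible by [t ^+ 2] in the product of the two expansions. *)
  exists (F * G + u * (mpoly.meval x g + t * G + t ^+ 2 * v) +
          v * (mpoly.meval x f + t * F)).
  rewrite !mpoly.mevalM fu gv -/F -/G.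
  have -> : \sum_l mpoly.meval x (mpoly.mderiv l (f * g)) * y l =
      F * mpoly.meval x g + mpoly.meval x f * G.
    rewrite mulr_suml mulr_sumr -big_split; apply: eq_bigr => l _ /=.
    by rewrite mpoly.mderivM mpoly.mevalD !mpoly.mevalM mulrDl mulrAC mulrA.
  by ring.
Qed.

Lemma meval_congr (n : nat) (R : comNzRingType) (f : mpoly.mpoly n R)
    (x y : 'I_n -> R) (t : R) :
  exists w, mpoly.meval (fun i => x i + t * y i) f = mpoly.meval x f + t * w.
Proof.
have [w ->] := meval_taylor f x y t.
exists (\sum_l mpoly.meval x (mpoly.mderiv l f) * y l + t * w).
by rewrite mulrDr addrA mulrA -expr2.
Qed.

(** Taylor expansion at [x0] with increment of size [p ^ e]. The derivative at [x0] agrees with that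
    at [a] modulo [p], and [p ^ (2 * e)] is a multiple of [p ^ e.+1] because [e] is positive. *)
Lemma polynomial_map_step (n k : nat) (P : 'I_k -> mpoly.mpoly n int)
    (a x0 z y : 'cV[int]_n) (p e : nat) :
  (0 < e)%N -> x0 = a + p%:Z *: z ->
  exists w : 'cV[int]_k, polynomial_map P (x0 + (p ^ e)%N%:Z *: y) =
    polynomial_map P x0 +
    (p ^ e)%N%:Z *: (polynomial_jacobian P a *m y + p%:Z *: w).
Proof.
move=> e0 x0a.
suff /choice[w wE] : forall i : 'I_k, exists w : int,
    polynomial_map P (x0 + (p ^ e)%N%:Z *: y) i 0 = polynomial_map P x0 i 0 +
    (p ^ e)%N%:Z * ((polynomial_jacobian P a *m y) i 0 + p%:Z * w).
  by exists (\col_i w i); apply/colP => i; rewrite wE !mxE.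
move=> i.
have [u uE] := meval_taylor (P i) (fun l => x0 l 0) (fun l => y l 0) (p ^ e)%N%:Z.
have /choice[v vE] : forall l, exists v : int,
    mpoly.meval (fun l => x0 l 0) (mpoly.mderiv l (P i)) =
    mpoly.meval (fun l => a l 0) (mpoly.mderiv l (P i)) + p%:Z * v.
  move=> l; have [v vE] := meval_congr (mpoly.mderiv l (P i))
    (fun l => a l 0) (fun l => z l 0) p%:Z.
  by exists v; rewrite -vE; apply: mpoly.meval_eq => l'; rewrite x0a !mxE.
exists (\sum_l v l * y l 0 + (p ^ e.-1)%N%:Z * u).
rewrite !mxE (@mpoly.meval_eq _ _ _ (fun l => x0 l 0 + (p ^ e)%N%:Z * y l 0)); last first.
  by move=> l; rewrite !mxE.
rewrite uE -addrA; congr (_ + _).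
under eq_bigr do rewrite vE mulrDl.
under [in RHS]eq_bigr do rewrite mxE.
rewrite big_split/=.
under [X in _ * (_ + X) + _]eq_bigr do rewrite -mulrA.
rewrite -mulr_sumr.
have -> : (p ^ e)%N%:Z ^+ 2 = (p ^ e)%N%:Z * (p%:Z * (p ^ e.-1)%N%:Z).
  by rewrite expr2 -[in X in _ * X = _](prednK e0) expnS PoszM.
by ring.
Qed.

(** For [x] in [x0 + p ^ e Z^k] the division is exact, and this is the next base-[p] digit of [x]
    relative to [x0], written as a row. *)
Definition digit (p e k : nat) (x0 x : 'cV[int]_k) : 'rV['F_p]_k :=
  \row_i (divz (x i 0 - x0 i 0) (p ^ e)%N%:Z)%:~R.

Lemma digitE (p e k : nat) (x0 y : 'cV[int]_k) : (0 < p)%N ->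
  digit p e x0 (x0 + (p ^ e)%N%:Z *: y) = map_mx intr y^T.
Proof.
move=> p0; apply/rowP => i; rewrite !mxE addrAC subrr add0r mulrC mulzK//.
by rewrite eqz_nat expn_eq0 negb_and -lt0n p0.
Qed.

Lemma map_intr_Fp_eq0 (p n : nat) (y : 'cV[int]_n) : prime p ->
  (map_mx intr y^T : 'rV['F_p]_n) = 0 -> exists z, y = p%:Z *: z.
Proof.
move=> pp /rowP y0; exists (\col_i divz (y i 0) p%:Z); apply/colP => i.
rewrite !mxE mulrC divzK// (dvdz_pcharf (pchar_Fp pp)).
by have := y0 i; rewrite !mxE => ->.
Qed.

(** Induction on the number [l] of scales still needed to separate the points of [E]. For [l = 0]
    there is at most one point. Otherwise [E] is split by the digit at scale [e]: the induction
    hypothesis bounds each part, and the inequality over ['F_p] sums the bounds. *)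
Lemma BL_inequality_multiscale (R : realType) (n m : nat) (d : 'I_m -> nat)
    (P : forall j : 'I_m, 'I_(d j) -> mpoly.mpoly n int) (s : 'I_m -> R)
    (a : 'cV[int]_n) (p : nat) (h : forall j : 'I_m, 'cV[int]_(d j) -> R) :
  prime p -> (forall j, 0 <= s j) -> (forall j y, 0 <= h j y) ->
  BL_inequality (fun j =>
    map_mx intr (polynomial_jacobian (P j) a)^T : 'M['F_p]_(n, d j)) s ->
  forall (l e : nat) (E : {fset 'cV[int]_n}) (x0 : 'cV[int]_n),
  (0 < e)%N -> (exists z, x0 = a + p%:Z *: z) ->
  (forall x, x \in E -> exists y, x = x0 + (p ^ e)%N%:Z *: y) ->
  (forall x x', x \in E -> x' \in E ->
    (exists y, x = x' + (p ^ (e + l))%N%:Z *: y) -> x = x') ->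
  \sum_(x <- E) \prod_j h j (polynomial_map (P j) x) `^ s j <=
  \prod_j (\sum_(y <- [fset polynomial_map (P j) x | x in E]%fset) h j y) `^ s j.
Proof.
move=> pp s0 h0 BL; have p0 := prime_gt0 pp.
elim=> [|l IH] e E x0 e0 [z x0a] Ee El.
  have [->|[x xE]] := fset_0Vmem E.
    by rewrite big_seq_fset0 prodr_ge0// => j _; exact: powR_ge0.
  have -> : E = [fset x]%fset.
    apply/fsetP => x'; rewrite inE; apply/idP/eqP => [x'E|->//].
    apply: El => //; rewrite addn0.
    have [y ->] := Ee x xE; have [y' ->] := Ee x' x'E.
    by exists (y' - y); rewrite scalerBr addrA addrAC addrK.
  rewrite big_seq_fset1; apply: ler_prod => j _; rewrite powR_ge0/=.
  by rewrite imfset_fset1 big_seq_fset1.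
pose u := digit p e x0.
pose kappa j := @digit p e (d j) (polynomial_map (P j) x0).
pose J j : 'M['F_p]_(n, d j) := map_mx intr (polynomial_jacobian (P j) a)^T.
have uJ x j : x \in E -> kappa j (polynomial_map (P j) x) = u x *m J j.
  move=> /Ee[y ->]; rewrite /kappa /u digitE//.
  have [w ->] := polynomial_map_step (P j) y e0 x0a.
  rewrite digitE// linearD/= linearZ/= map_mxD map_mxZ/=.
  by rewrite -pmulrn pchar_Fp_0// scale0r addr0 trmx_mul map_mxM.
pose T j := [fset polynomial_map (P j) x | x in E]%fset.
pose H j w := \sum_(y <- T j | kappa j y == w) h j y.
have H0 j w : 0 <= H j w by exact: sumr_ge0.
rewrite (partition_big_imfset _ u).
apply: (@le_trans _ _ (\sum_(w <- [fset u x | x in E]%fset)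
    \prod_j H j (w *m J j) `^ s j)).
  rewrite big_seq [leRHS]big_seq; apply: ler_sum => _ /imfsetP[x1 /= x1E ->].
  have [y1 x1y] := Ee x1 x1E.
  pose E1 := [fset x in E | u x == u x1]%fset.
  have sub x : x \in E1 -> x \in E by rewrite !inE => /andP[].
  have -> : \sum_(x <- E | u x == u x1)
      \prod_j h j (polynomial_map (P j) x) `^ s j =
      \sum_(x <- E1) \prod_j h j (polynomial_map (P j) x) `^ s j.
    by rewrite /E1 big_fset.
  (* Points with the same digit as [x1] lie in [x1 + p ^ e.+1 Z^n], so the part is recentred at
     [x1]. *)
  apply: le_trans (IH e.+1 E1 x1 isT _ _ _) _.
  - exists (z + (p ^ e.-1)%N%:Z *: y1); rewrite x1y x0a scalerDr scalerA addrA.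
    by rewrite -PoszM -expnS prednK.
  - move=> x; rewrite !inE => /andP[xE /eqP]; have [y xy] := Ee x xE.
    rewrite /u xy x1y !digitE// => /eqP.
    rewrite -subr_eq0 -map_mxB -linearB/= => /eqP /(map_intr_Fp_eq0 pp)[v yv].
    exists v; rewrite expnSr PoszM -scalerA -yv scalerBr -addrA.
    by rewrite (addrC (_ *: y1)) subrK.
  - move=> x x' /sub xE /sub x'E; rewrite addSnnS; exact: El.
  apply: ler_prod => j _; rewrite powR_ge0/=; apply: ge0_ler_powR => //.
  - by rewrite nnegrE sumr_ge0.
  - by rewrite nnegrE.
  (* Images of the points of [E1] all have the digit of the image of [x1], so they are among the
     terms of [H j]. *)
  rewrite /H -uJ// [leRHS]big_fset_condE; apply: ler_sum_fsubset => //.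
  apply/fsubsetP => _ /imfsetP[x /= xE1 ->]; rewrite !inE.
  have xE := sub x xE1; rewrite in_imfset//= !uJ//.
  by move: xE1; rewrite !inE => /andP[_ /eqP ->].
apply: le_trans (BL H (fun j => [fset kappa j y | y in T j]%fset) _ H0 _) _.
  move=> _ j /imfsetP[x /= xE ->]; apply/imfsetP.
  exists (polynomial_map (P j) x); last by rewrite -uJ.
  by rewrite in_imfset.
by rewrite le_eqVlt; apply/orP; left; apply/eqP/eq_bigr => j _;
  rewrite [in RHS](partition_big_imfset _ (kappa j)).
Qed.

(** * Computability of the exceptional integer *)

Lemma computes_Comp1 (e e1 : program) (xs : seq nat) (x y : nat) :
  computes e1 xs x -> computes e [:: x] y -> computes (Comp e [:: e1]) xs y.
Proof.
move=> c1 c; apply: computes_Comp c; apply: computes_cons c1 _.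
exact: computes_nil.
Qed.

Lemma computes_Comp2 (e e1 e2 : program) (xs : seq nat) (x1 x2 y : nat) :
  computes e1 xs x1 -> computes e2 xs x2 -> computes e [:: x1; x2] y ->
  computes (Comp e [:: e1; e2]) xs y.
Proof.
move=> c1 c2 c; apply: computes_Comp c; apply: computes_cons c1 _.
by apply: computes_cons c2 _; exact: computes_nil.
Qed.

(** The recursion variable is the first argument. In a recursion step [Proj 0] is the counter,
    [Proj 1] the previous value and [Proj 2] the parameter. *)
Definition add_program : program := PrimRec (Proj 0) (Comp Succ [:: Proj 1]).

Lemma computes_add (k x : nat) : computes add_program [:: k; x] (k + x)%N.
Proof.
elim: k => [|k IH]; first by apply: computes_PrimRec0; exact: (@computes_Proj 0 [:: x]).
apply: computes_PrimRecS IH _; apply: computes_Comp1 (computes_Succ _ _).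
exact: (@computes_Proj 1 [:: k; (k + x)%N; x]).
Qed.

Definition mul_program : program :=
  PrimRec Zero (Comp add_program [:: Proj 2; Proj 1]).

Lemma computes_mul (k x : nat) : computes mul_program [:: k; x] (k * x)%N.
Proof.
elim: k => [|k IH]; first by apply: computes_PrimRec0; exact: computes_Zero.
apply: computes_PrimRecS IH _; rewrite mulSn.
apply: computes_Comp2 (computes_add _ _).
  exact: (@computes_Proj 2 [:: k; (k * x)%N; x]).
exact: (@computes_Proj 1 [:: k; (k * x)%N; x]).
Qed.

Definition exp_program : program :=
  PrimRec (Comp Succ [:: Zero]) (Comp mul_program [:: Proj 2; Proj 1]).

Lemma computes_exp (k x : nat) : computes exp_program [:: k; x] (x ^ k)%N.
Proof.
elim: k => [|k IH].
  apply: computes_PrimRec0; apply: computes_Comp1 (computes_Succ _ _).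
  exact: computes_Zero.
apply: computes_PrimRecS IH _; rewrite expnS.
apply: computes_Comp2 (computes_mul _ _).
  exact: (@computes_Proj 2 [:: k; (x ^ k)%N; x]).
exact: (@computes_Proj 1 [:: k; (x ^ k)%N; x]).
Qed.

Definition fact_program : program :=
  PrimRec (Comp Succ [:: Zero])
    (Comp mul_program [:: Comp Succ [:: Proj 0]; Proj 1]).

Lemma computes_fact (k : nat) : computes fact_program [:: k] k`!.
Proof.
elim: k => [|k IH].
  apply: computes_PrimRec0; apply: computes_Comp1 (computes_Succ _ _).
  exact: computes_Zero.
apply: computes_PrimRecS IH _; rewrite factS.
apply: computes_Comp2 (computes_mul _ _).
  apply: computes_Comp1 (computes_Succ _ _).
  exact: (@computes_Proj 0 [:: k; k`!]).
exact: (@computes_Proj 1 [:: k; k`!]).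
Qed.

(* Dominates the bound of [rank_condition_Fp] when all the sizes and all the
   entries are at most [c]. *)
Definition prime_bound (c : nat) : nat :=
  let b := (c * c).+1 in ((b + b) ^ ((c * c) * (c`! * c.+1 ^ c)))%N.

(** The input is never decoded: the code itself bounds all the sizes and entries and is used as
    [c]. *)
Definition Delta_program : program :=
  let c := Proj 0 in
  let cc := Comp mul_program [:: c; c] in
  let b := Comp Succ [:: cc] in
  Comp fact_program [:: Comp exp_program [::
    Comp mul_program [:: cc; Comp mul_program [:: Comp fact_program [:: c];
      Comp exp_program [:: c; Comp Succ [:: c]]]];
    Comp add_program [:: b; b]]].

Lemma computes_Delta (c : nat) : computes Delta_program [:: c] (prime_bound c)`!.
Proof.
have cP : computes (Proj 0) [:: c] c by exact: (@computes_Proj 0 [:: c]).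
have ccP := computes_Comp2 cP cP (computes_mul c c).
have bP := computes_Comp1 ccP (computes_Succ _ [::]).
apply: computes_Comp1 (computes_fact _).
apply: computes_Comp2 (computes_exp _ _); last first.
  exact: (computes_Comp2 bP bP (computes_add _ _)).
apply: computes_Comp2 ccP _ (computes_mul _ _).
apply: computes_Comp2 (computes_Comp1 cP (computes_fact _)) _ (computes_mul _ _).
exact: computes_Comp2 cP (computes_Comp1 cP (computes_Succ _ _)) (computes_exp _ _).
Qed.

(** The code of [y :: s] is 2 to the power [y] times an odd number that exceeds the code of [s]. *)
Lemma leq_code (s : seq nat) (x : nat) : x \in s -> (x <= CodeSeq.code s)%N.
Proof.
elim: s => //= y s IH; rewrite inE => /orP[/eqP ->|/IH xs].
  by rewrite (leq_trans (ltnW (ltn_expl y (ltnSn 1))))// leq_pmulr.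
rewrite (leq_trans xs)//; apply: leq_trans (leq_pmull _ _); last by rewrite expn_gt0.
by rewrite ltnW// ltnS -addnn leq_addr.
Qed.

Lemma absz_le_code_int (z : int) : (`|z| <= code_int z)%N.
Proof. by case: z => k /=; rewrite ?absz_nat ?abszN1 -addnn ?leq_addr// NegzE abszN; lia. Qed.

Lemma leq_code_matrices (n m : nat) (d : 'I_m -> nat)
    (J : forall j : 'I_m, 'M[int]_(d j, n)) (c := code_matrices J) :
  [/\ (n <= c)%N, (m <= c)%N, forall j, (d j <= c)%N
    & forall j i k, (`|J j i k| <= c)%N].
Proof.
rewrite /c /code_matrices; split.
- by apply: leq_code; rewrite inE eqxx.
- by apply: leq_code; rewrite !inE eqxx orbT.
- move=> j; apply: leq_code; rewrite !inE mem_cat.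
  by rewrite (map_f (fun j => d j)) ?mem_enum// !orbT.
move=> j i k; apply: leq_trans (absz_le_code_int _) _.
apply: leq_code; rewrite !inE mem_cat; apply/orP; right; apply/orP; right.
apply/orP; right; apply/flattenP.
exists (flatten [seq [seq code_int (J j i k) | k <- enum 'I_n] | i <- enum 'I_(d j)]).
  by apply: map_f; rewrite mem_enum.
apply/flattenP; exists [seq code_int (J j i k) | k <- enum 'I_n].
  by apply: (map_f (fun i => [seq code_int (J j i k) | k <- enum 'I_n])); rewrite mem_enum.
by apply: (map_f (fun k => code_int (J j i k))); rewrite mem_enum.
Qed.

Lemma leq_prime_bound (n m : nat) (d : 'I_m -> nat) (c : nat) :
  (0 < m)%N -> (n <= c)%N -> (m <= c)%N -> (forall j, (d j <= c)%N) ->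
  ((n * c).+1.*2 ^ ((\sum_j d j) * (m`! * n.+1 ^ m)) <= prime_bound c)%N.
Proof.
move=> m0 nc mc dc; rewrite /prime_bound /= -addnn.
have c0 : (0 < c)%N := leq_trans m0 mc.
apply: (@leq_trans (((c * c).+1 + (c * c).+1) ^ ((\sum_j d j) * (m`! * n.+1 ^ m)))).
  case: (_ * (_ * _))%N => // E; rewrite leq_exp2r// leq_add// ltnS.
    by rewrite leq_mul2r nc orbT.
  by rewrite leq_mul2r nc orbT.
rewrite leq_exp2l; last by rewrite addSn addnS.
apply: leq_mul; last apply: leq_mul.
- apply: (@leq_trans (\sum_(j < m) c)); first by apply: leq_sum.
  by rewrite sum_nat_const card_ord leq_mul2r mc orbT.
- by rewrite leq_fact.
- by rewrite (@leq_trans (c.+1 ^ m))// ?leq_exp2r// leq_exp2l.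
Qed.

(** * Ranks of subgroups *)

Lemma clear_denominators (k n : nat) (A : 'M[rat]_(k, n)) :
  exists (c : int) (B : 'M[int]_(k, n)), c != 0 /\ map_mx intr B = c%:~R *: A.
Proof.
pose c := \prod_(t : 'I_k * 'I_n) denq (A t.1 t.2).
exists c, (\matrix_(i, j) (numq (A i j) *
  \prod_(t : 'I_k * 'I_n | t != (i, j)) denq (A t.1 t.2))); split.
  by apply/prodf_neq0 => t _; exact: denq_neq0.
apply/matrixP => i j; rewrite !mxE /c [in RHS](bigD1 (i, j))//= !intrM numqE.
by ring.
Qed.

(** A rational kernel vector becomes an integral one once its denominators are cleared. *)
Lemma row_free_int_inj (k r : nat) (B : 'M[int]_(k, r)) :
  row_free (map_mx intr B : 'M[rat]_(k, r))^T <->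
  injective (fun c : 'cV[int]_r => B *m c).
Proof.
split=> [Bfree c c' /(congr1 (map_mx (intr : int -> rat)))|Binj].
  rewrite !map_mxM => /(congr1 trmx); rewrite !trmx_mul => /(row_free_inj Bfree).
  by move=> /trmx_inj /map_intr_inj.
rewrite -kermx_eq0; apply/eqP/row_matrixP => i; rewrite row0.
have : row i (kermx (map_mx intr B : 'M[rat]_(k, r))^T) *m (map_mx intr B)^T = 0.
  by rewrite -row_mul mulmx_ker row0.
move: (row i _) => v vB.
have [c [w [c0 wE]]] := clear_denominators v.
have : B *m w^T = B *m 0.
  apply: map_intr_inj; rewrite mulmx0 map_mx0 map_mxM -map_trmx wE.
  by rewrite -[LHS]trmxK trmx_mul trmxK -scalemxAl vB scaler0 trmx0.
move=> /Binj /(congr1 trmx); rewrite trmxK trmx0 => w0.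
move: wE; rewrite w0 map_mx0 => /esym/eqP.
by rewrite scaler_eq0 intr_eq0 (negPf c0) => /eqP.
Qed.

Lemma range_mulmxP (k l r : nat) (M : 'M[int]_(k, l)) (B : 'M[int]_(k, r)) :
  range (fun c : 'cV[int]_l => M *m c) `<=` range (fun c : 'cV[int]_r => B *m c) ->
  exists X, M = B *m X.
Proof.
move=> MB; have /choice[x xE] : forall j : 'I_l, exists x : 'cV[int]_r, B *m x = col j M.
  move=> j; have [|x _ xE] := MB (col j M); last by exists x.
  by exists (delta_mx j 0) => //; rewrite colE.
exists (\matrix_(i, j) x j i 0); apply/matrixP => i j.
have /colP/(_ i) := xE j; rewrite !mxE => <-.
by apply: eq_bigr => l' _; rewrite !mxE.
Qed.

(** Two integer matrices with the same column span factor through each other, so they have the same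
    rational rank; that of a basis is its size. *)
Lemma Zbasis_rank (k l r : nat) (M : 'M[int]_(k, l)) (B : 'M[int]_(k, r)) :
  is_Zbasis (range (fun c : 'cV[int]_l => M *m c)) B -> r = matrix_rank M.
Proof.
move=> [/row_free_int_inj Bfree MB].
have /range_mulmxP[X MX] : range (fun c : 'cV[int]_l => M *m c) `<=`
  range (fun c : 'cV[int]_r => B *m c) by rewrite MB.
have /range_mulmxP[Y BY] : range (fun c : 'cV[int]_r => B *m c) `<=`
  range (fun c : 'cV[int]_l => M *m c) by rewrite MB.
have -> : r = matrix_rank B.
  by rewrite /matrix_rank -mxrank_tr; apply/esym/eqP.
apply/eqP; rewrite eqn_leq /matrix_rank; apply/andP; split.
  by rewrite {1}BY map_mxM mxrankM_maxl.
by rewrite {1}MX map_mxM mxrankM_maxl.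
Qed.

(** Both outcomes of [xget] satisfy the bound: a basis has the rational rank as its size, and the
    default value is 0. *)
Lemma free_rank_range_le (k l : nat) (M : 'M[int]_(k, l)) :
  (free_rank (range (fun c : 'cV[int]_l => M *m c)) <= matrix_rank M)%N.
Proof.
by rewrite /free_rank; case: xgetP => // r _ [B] /Zbasis_rank ->.
Qed.

Lemma free_rank_range_inj (k l : nat) (M : 'M[int]_(k, l)) :
  injective (fun c : 'cV[int]_l => M *m c) ->
  free_rank (range (fun c : 'cV[int]_l => M *m c)) = l.
Proof.
move=> Minj; rewrite /free_rank.
have MM : is_Zbasis (range (fun c : 'cV[int]_l => M *m c)) M by [].
rewrite [RHS](Zbasis_rank MM).
by case: xgetP => [r _ [B /Zbasis_rank ->//]|/(_ l)[]]; exists M.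
Qed.

(** Clearing denominators in a basis of the rational subspace gives a Z-basis of a subgroup of the
    same rank. Its images have rank at most that of the rational images, which suffices since the
    weights are nonnegative. *)
Lemma rank_condition_of_subgroups (R : realFieldType) (n m : nat) (d : 'I_m -> nat)
    (J : forall j, 'M[int]_(d j, n)) (s : 'I_m -> R) :
  (forall j, 0 <= s j <= 1) ->
  (forall V : set 'cV[int]_n, zmod_closed (mem V) ->
    (free_rank V)%:R <= \sum_j s j * (free_rank [set J j *m v | v in V])%:R) ->
  rank_condition (fun j => map_mx intr (J j)^T : 'M[rat]_(n, d j)) s.
Proof.
move=> s01 sV; split=> // k A.
have [c [W [c0 WE]]] := clear_denominators (row_base A).
have cn0 : c%:~R != 0 :> rat by rewrite intr_eq0.
pose B := W^T.
have Binj : injective (fun x : 'cV[int]_(\rank A) => B *m x).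
  apply/row_free_int_inj; rewrite /B map_trmx trmxK WE /row_free.
  by rewrite mxrank_scale_nz//; exact: row_base_free.
have := sV (range (fun x : 'cV[int]_(\rank A) => B *m x)).
rewrite free_rank_range_inj// => sB; apply: le_trans (sB _) _.
  split=> [|x y]; first by rewrite inE; exists 0 => //; rewrite mulmx0.
  rewrite !inE => -[u _ <-] [v _ <-]; exists (u - v) => //.
  by rewrite mulmxBr.
apply: ler_sum => j _; rewrite ler_wpM2l//; first by case/andP: (s01 j).
rewrite ler_nat image_comp.
have -> : [set J j *m (B *m x) | x in setT] =
          range (fun x : 'cV[int]_(\rank A) => (J j *m B) *m x).
  by apply: eq_imagel => x _ /=; rewrite mulmxA.
apply: leq_trans (free_rank_range_le _) _.
rewrite /matrix_rank -mxrank_tr map_trmx trmx_mul /B trmxK map_mxM WE.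
by rewrite -scalemxAl mxrank_scale_nz// (eqmxMr _ (eq_row_base A)).
Qed.

(** * Norms and unconditional sums *)

Lemma all_measurable (T : pointedType) (A : set (g_sigma_algebraType [set: set T])) :
  measurable A.
Proof. exact: sub_sigma_algebra. Qed.

Lemma counting_set1 (R : realType) (T : choiceType) (x : T) :
  counting [set x] = 1%E :> \bar R.
Proof. by rewrite /counting asboolT// fset_set1 cardfs1. Qed.

Lemma counting_setT_gt0 (R : realType) (T : pointedType) :
  (0 < counting [set: T] :> \bar R)%E.
Proof.
rewrite /counting; case: asboolP => [fT|_]; last by rewrite ltry.
rewrite lte_fin ltr0n cardfs_gt0; apply/fset0Pn; exists point.
by rewrite in_fset_set// inE.
Qed.

Lemma sum_le_counting_integral (R : realType) (T : pointedType) (A : {fset T})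
    (g : T -> R) : (forall x, 0 <= g x) ->
  ((\sum_(x <- A) g x)%:E <=
   \int[@counting (g_sigma_algebraType [set: set T]) R]_x (g x)%:E)%E.
Proof.
move=> g0.
pose D := \big[setU/set0]_(x <- A) [set x : g_sigma_algebraType [set: set T]].
apply: (@le_trans _ _
    (\int[@counting (g_sigma_algebraType [set: set T]) R]_(x in D) (g x)%:E)%E).
  rewrite ge0_integral_bigsetU//=.
  - rewrite -sumEFin; apply: lee_sum => x _.
    rewrite (@eq_integral _ _ _ _ _ (cst (g x)%:E)); last first.
      by move=> y; rewrite inE => ->.
    rewrite integral_cst; last exact: all_measurable.
    by rewrite [X in (_ * X)%E]counting_set1 mule1.
  - by move=> x; exact: all_measurable.
  - by move=> x y _ _ [z [-> ->]].
  - by move=> _ Y _; exact: all_measurable.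
  - by move=> x _; rewrite lee_fin.
apply: ge0_subset_integral => //.
- exact: all_measurable.
- by move=> _ Y _; exact: all_measurable.
- by move=> x _; rewrite lee_fin.
Qed.

Lemma lq_norm_ge0 (R : realType) (T : pointedType) (q : \bar R) (f : T -> R[i]) :
  (0 <= lq_norm q f)%E.
Proof. exact: Lnorm_ge0. Qed.

Lemma normc_ge0 (R : realType) (z : R[i]) : 0 <= Normc.normc z.
Proof. by case: z => a b; exact: sqrtr_ge0. Qed.

Lemma lq_norm_fin_ge (R : realType) (T : pointedType) (r : R) (f : T -> R[i])
    (A : {fset T}) : 0 < r ->
  (((\sum_(x <- A) Normc.normc (f x) `^ r) `^ r^-1)%:E <= lq_norm r%:E f)%E.
Proof.
move=> r0; rewrite /lq_norm Lnorm.unlock /=.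
have := @sum_le_counting_integral R T A (fun x => Normc.normc (f x) `^ r)
  (fun x => powR_ge0 _ _).
under [X in (_ <= X)%E -> _]eq_integral do
  rewrite -[Normc.normc _]ger0_norm ?normc_ge0//.
move=> h; rewrite -poweR_EFin gt0_ler_poweR//.
- by rewrite invr_ge0 ltW.
- by rewrite in_itv/= lee_fin leey andbT sumr_ge0// => x _; exact: powR_ge0.
- by rewrite in_itv/= leey andbT integral_ge0// => x _; exact: poweR_ge0.
Qed.

(** A null set of the counting measure is empty, so the essential supremum bounds every value. *)
Lemma lq_norm_infty_ge (R : realType) (T : pointedType) (f : T -> R[i]) (x : T) :
  ((Normc.normc (f x))%:E <= lq_norm +oo f)%E.
Proof.
rewrite /lq_norm Lnorm.unlock /= counting_setT_gt0.
have [N [_ N0 fN]] := ess_sup_ge (@counting (g_sigma_algebraType [set: set T]) R)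
  (abse \o (fun y => (Normc.normc (f y))%:E)).
have [fx|fx] := leP (Normc.normc (f x))%:E (ess_sup
  (@counting (g_sigma_algebraType [set: set T]) R)
  (abse \o (fun y => (Normc.normc (f y))%:E))); first by [].
have : N x.
  apply: fN => /=; rewrite ger0_norm ?normc_ge0// => h.
  by move: fx; rewrite ltNge h.
move=> Nx; have : (@counting (g_sigma_algebraType [set: set T]) R [set x : T] <=
  @counting (g_sigma_algebraType [set: set T]) R N)%E.
  apply: le_measure; rewrite ?inE; try exact: all_measurable.
  by move=> _ ->.
by rewrite N0 counting_set1 lee_fin ler10.
Qed.

Lemma unconditional_sum_ge0 (R : realType) (T : choiceType) (g : T -> R) (M : R) :
  (forall x, 0 <= g x) -> (forall E : {fset T}, \sum_(x <- E) g x <= M) ->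
  exists a, forall e, 0 < e -> exists E0 : {fset T}, forall E : {fset T},
    (E0 `<=` E)%fset -> `|a - \sum_(x <- E) g x| < e.
Proof.
move=> g0 gM; pose S := [set \sum_(x <- E) g x | E in [set: {fset T}]].
have Sub : has_ubound S by exists M => _ [E _ <-].
have Ssup : has_sup S by split=> //; exists (\sum_(x <- fset0) g x), fset0.
exists (sup S) => e e0; have [_ [E0 _ <-] supE0] := sup_adherent e0 Ssup.
exists E0 => E E0E.
have SE : \sum_(x <- E) g x <= sup S by apply: ub_le_sup => //; exists E.
rewrite ger0_norm ?subr_ge0// ltrBlDr -ltrBlDl (lt_le_trans supE0)//.
exact: ler_sum_fsubset.
Qed.

(** Write [g] as the difference of [|g| + g] and [|g|], two nonnegative functions with bounded
    finite sums; for these the limit is the supremum. *)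
Lemma unconditional_sum (R : realType) (T : choiceType) (g : T -> R) (M : R) :
  (forall E : {fset T}, \sum_(x <- E) `|g x| <= M) ->
  exists a, forall e, 0 < e -> exists E0 : {fset T}, forall E : {fset T},
    (E0 `<=` E)%fset -> `|a - \sum_(x <- E) g x| < e.
Proof.
move=> gM.
have [||a aP] := @unconditional_sum_ge0 R T (fun x => `|g x| + g x) (M + M).
- by move=> x; rewrite -lerBlDr sub0r ler_normr lexx orbT.
- move=> E; rewrite big_split/= lerD// (le_trans _ (gM E))//.
  by apply: ler_sum => x _; exact: ler_norm.
have [//|b bP] := @unconditional_sum_ge0 R T (fun x => `|g x|) M _ gM.
exists (a - b) => e e0; have e20 : 0 < e / 2 by rewrite divr_gt0.
have [E1 aE1] := aP _ e20; have [E2 bE2] := bP _ e20.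
exists (E1 `|` E2)%fset => E; rewrite fsubUset => /andP[E1E E2E].
have := aE1 E E1E; have := bE2 E E2E; rewrite big_split/=.
move: (\sum_(x <- E) `|g x|) (\sum_(x <- E) g x) => u v hb ha.
have -> : a - b - v = (a - (u + v)) - (b - u) by lra.
by rewrite (le_lt_trans (ler_normB _ _))// [ltRHS](splitr e) ltrD.
Qed.

Lemma Re_le_normc (R : realType) (z : R[i]) : `|complex.Re z| <= Normc.normc z.
Proof.
case: z => x y /=; rewrite -sqrtr_sqr ler_wsqrtr// lerDl.
exact: sqr_ge0.
Qed.

Lemma Im_le_normc (R : realType) (z : R[i]) : `|complex.Im z| <= Normc.normc z.
Proof.
case: z => x y /=; rewrite -sqrtr_sqr ler_wsqrtr// lerDr.
exact: sqr_ge0.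
Qed.

Lemma normc_le_Re_Im (R : realType) (z : R[i]) :
  Normc.normc z <= `|complex.Re z| + `|complex.Im z|.
Proof.
case: z => x y /=; rewrite -[leRHS]ger0_norm ?addr_ge0// -sqrtr_sqr ler_wsqrtr//.
rewrite -(real_normK (num_real x)) -(real_normK (num_real y)) sqrrD.
by rewrite addrAC lerDl mulrn_wge0 ?mulr_ge0.
Qed.

Lemma has_sum_bounded (R : realType) (T : choiceType) (D : set T) (F : T -> R[i])
    (M : R) :
  (forall E : {fset T}, (forall x, x \in E -> D x) ->
    \sum_(x <- E) Normc.normc (F x) <= M) ->
  exists S, has_sum D F S /\ Normc.normc S <= M.
Proof.
move=> FM; pose G := patch (fun=> 0) D F.
have GM (E : {fset T}) : \sum_(x <- E) Normc.normc (G x) <= M.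
  apply: le_trans (FM [fset x in E | x \in D]%fset _); last first.
    by move=> x; rewrite !inE => /andP[_]; rewrite inE.
  rewrite big_fset/= [leRHS]big_mkcond; apply: ler_sum => x _.
  by rewrite /G /patch; case: ifP => // _; rewrite Normc.normc0.
have [a aP] : exists a, forall e, 0 < e -> exists E0 : {fset T}, forall E : {fset T},
    (E0 `<=` E)%fset -> `|a - \sum_(x <- E) complex.Re (G x)| < e.
  apply: (@unconditional_sum _ _ _ M) => E; apply: le_trans (GM E).
  by apply: ler_sum => x _; exact: Re_le_normc.
have [b bP] : exists b, forall e, 0 < e -> exists E0 : {fset T}, forall E : {fset T},
    (E0 `<=` E)%fset -> `|b - \sum_(x <- E) complex.Im (G x)| < e.
  apply: (@unconditional_sum _ _ _ M) => E; apply: le_trans (GM E).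
  by apply: ler_sum => x _; exact: Im_le_normc.
have SP e : 0 < e -> exists E0 : {fset T}, forall E : {fset T},
    (E0 `<=` E)%fset -> Normc.normc ((a +i* b)%C - \sum_(x <- E) G x) < e.
  move=> e0; have e20 : 0 < e / 2 by rewrite divr_gt0.
  have [E1 aE1] := aP _ e20; have [E2 bE2] := bP _ e20.
  exists (E1 `|` E2)%fset => E; rewrite fsubUset => /andP[E1E E2E].
  apply: le_lt_trans (normc_le_Re_Im _) _.
  rewrite !raddfB !raddf_sum/= [ltRHS](splitr e) ltrD//.
    by rewrite sumrN; exact: aE1.
  by rewrite sumrN; exact: bE2.
exists (a +i* b)%C; split.
  have FT : Filter (@totally T) by apply: filter_filter; exact: totally_filter.
  (* The radius [eps] is a complex number; its positivity means that it is real and positive. *)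
  rewrite /has_sum; apply/(@cvgrPdist_lt _ (R[i]^o)) => eps; rewrite ltcE => /andP[/eqP eps_im eps0].
  have [E0 SE0] := SP _ eps0; exists E0 => // E /= E0E.
  have -> : partial_sum G E = \sum_(x <- E) G x by rewrite /partial_sum big_seq_fsetE.
  rewrite ltcE; apply/andP; split; first by rewrite eps_im.
  exact: SE0.
apply/ler_addgt0Pl => e e0; have [E0 SE0] := SP _ e0.
have SS : (a +i* b)%C = ((a +i* b)%C - \sum_(x <- E0) G x) + \sum_(x <- E0) G x.
  by rewrite subrK.
rewrite [X in Normc.normc X]SS; apply: le_trans (le_normcD _ _) _.
apply: lerD; first exact/ltW/SE0.
apply: le_trans (GM E0).
elim/big_ind2: _ => //; first by rewrite Normc.normc0.
by move=> u1 r1 u2 r2 h1 h2; apply: le_trans (le_normcD _ _) (lerD h1 h2).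
Qed.

(** * The theorem *)

(** With [B] bounding all coordinates, two of them differ by at most [B.*2], which is less than
    [p ^ B.*2]. *)
Lemma fset_separated (n p : nat) (E : {fset 'cV[int]_n}) : (1 < p)%N ->
  exists l, forall x x', x \in E -> x' \in E ->
    (exists y, x = x' + (p ^ l)%N%:Z *: y) -> x = x'.
Proof.
move=> p1; pose B := (\sum_(x <- E) \sum_i `|(x : 'cV[int]_n) i 0%R|)%N.
have xB x i : x \in E -> (`|x i 0%R| <= B)%N.
  move=> xE; rewrite /B (big_fsetD1 x)//= (bigD1 i)//= -addnA; exact: leq_addr.
exists B.*2 => x x' xE x'E [y xy]; apply/colP => i.
have := xB x i xE; have := xB x' i x'E; have := ltn_expl B.*2 p1.
have : x i 0 = x' i 0 + (p ^ B.*2)%N%:Z * y i 0 by rewrite xy !mxE.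
move: (p ^ B.*2)%N (x i 0) (x' i 0) (y i 0) => Q u v w uv BQ vB uB.
have [w0|w0] := eqVneq w 0; first by rewrite uv w0 mulr0 addr0.
have : (1 <= `|w|)%N by rewrite absz_gt0.
nia.
Qed.

Definition inv_exponent (R : realType) (q : \bar R) : R := fine (q^-1)%E.

Lemma inv_exponent01 (R : realType) (q : \bar R) : (1 <= q)%E ->
  0 <= inv_exponent q <= 1.
Proof.
rewrite /inv_exponent; case: q => [r| |]//=; last by rewrite ?invey/= ?lexx ler01.
rewrite lee_fin => r1; have r0 : 0 < r by apply: lt_le_trans r1.
by rewrite inver gt_eqF//= invr_ge0 ltW//= invf_le1.
Qed.

Lemma inv_exponentE (R : realType) (q : \bar R) (c : R) : (1 <= q)%E ->
  (c%:E / q)%E = (inv_exponent q * c)%:E.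
Proof.
rewrite /inv_exponent; case: q => [r| |]//=; last by rewrite ?invey/= ?mule0 mul0r.
rewrite lee_fin => r1; have r0 : 0 < r by apply: lt_le_trans r1.
by rewrite inver gt_eqF//= -EFinM mulrC.
Qed.

(* When the exponent is [+oo], its inverse is [0] and the norm goes into the
   constant [C]. *)
Lemma lq_norm_majorant (R : realType) (T : pointedType) (q : \bar R)
    (f : T -> R[i]) (r : R) : (1 <= q)%E -> lq_norm q f = r%:E ->
  exists (C : R) (h : T -> R), [/\ 0 <= C, forall y, 0 <= h y,
    forall y, Normc.normc (f y) <= C * h y `^ inv_exponent q
    & forall A : {fset T}, C * (\sum_(y <- A) h y) `^ inv_exponent q <= r].
Proof.
move=> q1 fr; case: q q1 fr => [t| |]//.
  rewrite lee_fin => t1 fr; have t0 : 0 < t by apply: lt_le_trans t1.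
  have tE : inv_exponent t%:E = t^-1 by rewrite /inv_exponent inver gt_eqF.
  exists 1, (fun y => Normc.normc (f y) `^ t); split=> //.
  - by move=> y; exact: powR_ge0.
  - move=> y; rewrite mul1r tE -powRrM mulfV ?gt_eqF// powRr1//.
    exact: normc_ge0.
  - by move=> A; rewrite mul1r tE -lee_fin -fr lq_norm_fin_ge.
move=> _ fr; have fle y : Normc.normc (f y) <= r.
  by rewrite -lee_fin -fr lq_norm_infty_ge.
have tE : inv_exponent (+oo : \bar R)%E = 0 by rewrite /inv_exponent invey.
exists r, (fun=> 1); split=> //.
- by rewrite (le_trans (normc_ge0 (f point))).
- by move=> y; rewrite tE powRr0 mulr1.
- by move=> A; rewrite tE powRr0 mulr1.
Qed.

Lemma lq_norm_eq0 (R : realType) (T : pointedType) (q : \bar R) (f : T -> R[i]) :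
  (1 <= q)%E -> lq_norm q f = 0%E -> forall y, f y = 0.
Proof.
move=> q1 f0 y; have [C [h [C0 h0 fle fA]]] := lq_norm_majorant q1 f0.
apply: Normc.eq0_normc; apply/eqP; rewrite eq_le normc_ge0 andbT.
by rewrite (le_trans (fle y))//; have := fA [fset y]%fset; rewrite big_seq_fset1.
Qed.

Lemma normc_prod (R : realType) (I : Type) (r : seq I) (F : I -> R[i]) :
  Normc.normc (\prod_(i <- r) F i) = \prod_(i <- r) Normc.normc (F i).
Proof. exact: (big_morph _ (@Normc.normcM R) (@Normc.normc1 R)). Qed.

(** Each [f j] is replaced by its majorant, then the multiscale inequality is started at scale 1
    around [a], the scale of the coset itself. *)
Theorem multilinear_sum_le (R : realType) (n m : nat) (d : 'I_m -> nat)
    (P : forall j : 'I_m, 'I_(d j) -> mpoly.mpoly n int) (q : 'I_m -> \bar R)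
    (a : 'cV[int]_n) (p : nat) (f : forall j : 'I_m, 'cV[int]_(d j) -> R[i])
    (r : 'I_m -> R) (E : {fset 'cV[int]_n}) :
  prime p -> (forall j, (1 <= q j)%E) ->
  rank_condition (fun j =>
    map_mx intr (polynomial_jacobian (P j) a)^T : 'M['F_p]_(n, d j))
    (fun j => inv_exponent (q j)) ->
  (forall j, lq_norm (q j) (f j) = (r j)%:E) ->
  (forall x, x \in E -> coset_pZ p a x) ->
  \sum_(x <- E) Normc.normc (\prod_j f j (polynomial_map (P j) x)) <= \prod_j r j.
Proof.
move=> pp q1 /BL_inequality_linear BL fr Ea.
have s0 j : 0 <= inv_exponent (q j) by case/andP: (inv_exponent01 (q1 j)).
have /choice[C CP] := fun j => lq_norm_majorant (q1 j) (fr j).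
have {CP} [h CP] : exists h : forall j, 'cV[int]_(d j) -> R, forall j,
    [/\ 0 <= C j, forall y, 0 <= h j y,
      forall y, Normc.normc (f j y) <= C j * h j y `^ inv_exponent (q j)
    & forall A : {fset 'cV[int]_(d j)},
        C j * (\sum_(y <- A) h j y) `^ inv_exponent (q j) <= r j].
  exists (fun j => projT1 (cid (CP j))) => j.
  exact: (projT2 (cid (CP j))).
have h0 j y : 0 <= h j y by case: (CP j).
have C0 j : 0 <= C j by case: (CP j).
have [l El] := fset_separated E (prime_gt1 pp).
apply: (@le_trans _ _ (\prod_j C j *
    \sum_(x <- E) \prod_j h j (polynomial_map (P j) x) `^ inv_exponent (q j))).
  rewrite mulr_sumr; apply: ler_sum => x _; rewrite normc_prod -big_split/=.
  by apply: ler_prod => j _; rewrite normc_ge0/=; case: (CP j).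
have := @BL_inequality_multiscale R n m d P (fun j => inv_exponent (q j)) a p h
  pp s0 h0 BL l 1 E a isT.
move=> H; apply: le_trans (ler_wpM2l _ (H _ _ _)) _.
- by rewrite prodr_ge0.
- by exists 0; rewrite scaler0 addr0.
- move=> x /Ea[y _ <-]; exists y; rewrite expn1; congr (_ + _).
  by apply/colP => i; rewrite mulmxnE mxE -mulr_natl natz.
- move=> x x' xE x'E [y xy]; apply: El => //; exists (p%:Z *: y).
  by rewrite scalerA -PoszM mulnC -expnS.
rewrite -big_split/=; apply: ler_prod => j _.
by rewrite mulr_ge0 ?powR_ge0//=; case: (CP j).
Qed.

Theorem theorem1p1 (R : realType) :
  exists (Delta : forall (n m : nat) (d : 'I_m -> nat),
                    (forall j : 'I_m, 'M[int]_(d j, n)) -> nat)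
         (algo : program),
  forall (n m : nat) (d : 'I_m -> nat)
    (P : forall j : 'I_m, 'I_(d j) -> mpoly.mpoly n int)
    (q : 'I_m -> \bar R) (a : 'cV[int]_n),
  (0 < n)%N -> (0 < m)%N -> (forall j, (0 < d j)%N) ->
  (forall j, ~ in_proper_affine_subspace (range (polynomial_map (P j)))) ->
  (forall j, (1 <= q j)%E) ->
  (n%:R%:E = \sum_(j < m) (d j)%:R%:E / q j)%E ->
  (forall j, matrix_rank (polynomial_jacobian (P j) a) = d j) ->
  (forall V : set 'cV[int]_n, zmod_closed (mem V) ->
    ((free_rank V)%:R%:E <=
     \sum_(j < m)
       (free_rank [set (polynomial_jacobian (P j) a) *m v | v in V])%:R%:E / q j)%E) ->
  let J := fun j : 'I_m => polynomial_jacobian (P j) a in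
  [/\ computes algo [:: code_matrices J] (Delta n m d J),
      (0 < Delta n m d J)%N
    & forall p : nat, prime p -> ~~ (p %| Delta n m d J)%N ->
      forall f : (forall j : 'I_m, 'cV[int]_(d j) -> R[i]),
      (\prod_(j < m) lq_norm (q j) (f j) < +oo)%E ->
      exists S : R[i],
        has_sum (coset_pZ p a) (fun x => \prod_(j < m) f j (polynomial_map (P j) x)) S
        /\ ((Normc.normc S)%:E <= \prod_(j < m) lq_norm (q j) (f j))%E].
Proof.
exists (fun n m d J => (prime_bound (code_matrices J))`!), Delta_program.
move=> n m d P q a _ m0 _ _ q1 _ _ sub J.
split; [exact: computes_Delta | exact: fact_gt0 |] => p pp pDelta f fin.
have pbig : (prime_bound (code_matrices J) < p)%N.
  (* A prime not exceeding the bound divides its factorial. *)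
  rewrite ltnNge; apply: contra pDelta => ple.
  by rewrite dvdn_fact// prime_gt0.
have [nc mc dc Jc] := leq_code_matrices J.
have rankFp : rank_condition (fun j => map_mx intr (J j)^T : 'M['F_p]_(n, d j))
    (fun j => inv_exponent (q j)).
  apply: (rank_condition_Fp (c := code_matrices J)) => //.
  - by move=> j i l; rewrite mxE.
  - exact: leq_ltn_trans (leq_prime_bound m0 nc mc dc) pbig.
  apply: rank_condition_of_subgroups => [j|V Vzmod]; first exact: inv_exponent01.
  rewrite -lee_fin -sumEFin; under eq_bigr do rewrite -inv_exponentE//.
  exact: sub.
have prod_ge0 : (0 <= \prod_(j < m) lq_norm (q j) (f j))%E.
  by apply: prode_ge0 => j _; exact: lq_norm_ge0.
(* A zero norm is treated apart, since another norm may then be infinite while the product is 0. If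
   all norms are positive, finiteness of the product makes each of them finite. *)
have [[i fi0]|f_neq0] := pselect (exists i, lq_norm (q i) (f i) = 0%E).
  have [|S [FS S0]] := @has_sum_bounded R _ (coset_pZ p a)
      (fun x => \prod_(j < m) f j (polynomial_map (P j) x)) 0.
    move=> E _; rewrite big1// => x _.
    by rewrite (bigD1 i)//= (lq_norm_eq0 (q1 i) fi0) mul0r Normc.normc0.
  by exists S; split=> //; apply: le_trans prod_ge0; rewrite lee_fin.
have norm_gt0 j : (0 < lq_norm (q j) (f j))%E.
  rewrite lt_def lq_norm_ge0 andbT; apply/eqP => fj0; apply: f_neq0.
  by exists j.
have /choice[r fr] : forall j, exists r, lq_norm (q j) (f j) = r%:E.
  move=> i; case fi : (lq_norm (q i) (f i)) => [r| |]; first by exists r.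
    move: fin; rewrite (bigD1 i)//= fi gt0_mulye ?ltxx//.
    by elim/big_ind : _ => // x y; exact: mule_gt0.
  by have := norm_gt0 i; rewrite fi.
have -> : (\prod_(j < m) lq_norm (q j) (f j))%E = (\prod_(j < m) r j)%:E.
  by rewrite -prodEFin; apply: eq_bigr => j _; rewrite fr.
apply: has_sum_bounded => E Ea.
exact: multilinear_sum_le pp q1 rankFp fr Ea.
Qed.
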